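(* Let $d\ge 1$, let $I_0,J_0\subset\mathbf{R}^d$ be rectangular boxes with unit side length, let $\Phi\in C^3(I_0\times J_0)$ be real-valued, let $p\in C^1(I_0\times J_0)$ be complex-valued, and let $C_D(X),C_D(Y)>0$ and $0<c_N\le 1$. Then there exist $\varepsilon_0>0$ and $C>0$, independent of $h$, such that the following holds for every $h\in(0,1)$. Let $\mu_X,\mu_Y$ be probability measures on $\mathbf{R}^d$ with compact supports $X=\operatorname{supp}\mu_X\subset I_0$ and $Y=\operatorname{supp}\mu_Y\subset J_0$, which are doubling on scales $[h,1]$ with constants $C_D(X)$ and $C_D(Y)$ respectively, and such that $(X,Y)$ is $\Phi$-nonorthogonal with constant $c_N$ from scales $h$ to $1$. Let $$\mathcal{B}_hf(x)=\int_Y\exp\left(\frac{i\Phi(x,y)}{h}\right)p(x,y)f(y)\,d\mu_Y(y).$$ Then $$\|\mathcal{B}_h\|_{L^2(\mu_Y)\to L^2(\mu_X)}\le C h^{\varepsilon_0}.$$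
   Context: Doubling: a measure $\mu$ on $\mathbf{R}^d$ is doubling on scales $[h,1]$ with constant $C_D>0$ if for every $r\in[h,\tfrac12]$ and every (axis-parallel) cube $I$ of side length $r$ centered at a point of $\operatorname{supp}\mu$, $\mu(I\cdot 2)\le C_D\,\mu(I)$, where $I\cdot 2$ is the dilation of $I$ by the factor $2$ about its center. Nonorthogonality: for sets $X,Y\subseteq\mathbf{R}^d$ and a real-valued function $\Phi$ defined on a set containing $X\times Y$, $(X,Y)$ is $\Phi$-nonorthogonal with constant $0<c_N\le1$ from scales $(\alpha_0^X,\alpha_0^Y)$ to $(\alpha_1^X,\alpha_1^Y)$ if for any $x_0\in X$, $y_0\in Y$, $r_X\in(\alpha_0^X,\alpha_1^X)$ and $r_Y\in(\alpha_0^Y,\alpha_1^Y)$ there exist $x_1,x_2\in X\cap B(x_0,r_X)$ and $y_1,y_2\in Y\cap B(y_0,r_Y)$ (Euclidean balls) such that $$|\Phi(x_1,y_1)-\Phi(x_2,y_1)-\Phi(x_1,y_2)+\Phi(x_2,y_2)|\ge c_N r_Xr_Y.$$ ''From scales $h$ to $1$'' means from scales $(h,h)$ to $(1,1)$. *)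

(* Defs.v *)
From HB Require Import structures.
From mathcomp Require Import all_boot all_order all_algebra.
From mathcomp Require Import complex.
From mathcomp Require Import all_classical all_reals all_analysis.

Set Implicit Arguments.
Unset Strict Implicit.
Unset Printing Implicit Defensive.

Import Order.TTheory GRing.Theory Num.Theory.
Import numFieldNormedType.Exports.

Local Open Scope classical_set_scope.
Local Open Scope ring_scope.

(* The library norm on 'rV[R]_d is the sup norm. *)
Definition euclid_norm (R : realType) (d : nat) (x : 'rV[R]_d) : R :=
  Num.sqrt (\sum_(i < d) (x 0 i) ^+ 2).

Definition euclid_ball (R : realType) (d : nat) (c : 'rV[R]_d) (r : R) :
    set 'rV[R]_d :=
  [set x | euclid_norm (x - c) < r].

(* closed cube; s is the side length, not the half-side *)
Definition cube (R : realType) (d : nat) (c : 'rV[R]_d) (s : R) :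
    set 'rV[R]_d :=
  [set x | forall i, `|x 0 i - c 0 i| <= s / 2].

Definition unit_box (R : realType) (d : nat) (a : 'rV[R]_d) : set 'rV[R]_d :=
  [set x | forall i, a 0 i <= x 0 i <= a 0 i + 1].

(* Cartesian product, with R^m x R^n identified with R^(m + n) *)
Definition prod_rV (R : realType) (m n : nat)
    (A : set 'rV[R]_m) (B : set 'rV[R]_n) : set 'rV[R]_(m + n) :=
  [set z | A (lsubmx z) /\ B (rsubmx z)].

(* Increments stay in K, so the derivative is one-sided on the faces of a
   closed box. *)
Definition is_partial_within (R : realType) (n : nat) (K : set 'rV[R]_n)
    (f : 'rV[R]_n -> R) (i : 'I_n) (x : 'rV[R]_n) (l : R) : Prop :=
  (fun t : R => t^-1 * (f (x + t *: delta_mx 0 i) - f x))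
    @ within [set t : R | K (x + t *: delta_mx 0 i)] 0^' --> l.

(* C^k on a closed box K: all iterated partial derivatives of order <= k,
   taken relative to K, exist and are continuous on K. *)
Fixpoint C_on (R : realType) (n : nat) (k : nat) (K : set 'rV[R]_n)
    (f : 'rV[R]_n -> R) : Prop :=
  {within K, continuous f} /\
  match k with
  | 0%N => True
  | k'.+1 => exists g : 'I_n -> 'rV[R]_n -> R, forall i : 'I_n,
      (forall x, K x -> is_partial_within K f i x (g i x)) /\
      C_on k' K (g i)
  end.

Definition borel_rV (R : realType) (d : nat) :=
  g_sigma_algebraType (@open 'rV[R]_d).

Definition supp (R : realType) (d : nat) (mu : probability (borel_rV R d) R) :
    set 'rV[R]_d :=
  [set x | forall U : set 'rV[R]_d, open U -> U x -> (0 < mu U)%E].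

Definition doubling (R : realType) (d : nat)
    (mu : probability (borel_rV R d) R) (h CD : R) : Prop :=
  forall (c : 'rV[R]_d) (r : R), supp mu c -> h <= r <= 1 / 2 ->
    (mu (cube c (2 * r)) <= CD%:E * mu (cube c r))%E.

Definition nonorthogonal (R : realType) (d : nat)
    (Phi : 'rV[R]_d -> 'rV[R]_d -> R) (X Y : set 'rV[R]_d)
    (cN aX0 aY0 aX1 aY1 : R) : Prop :=
  forall (x0 y0 : 'rV[R]_d) (rX rY : R), X x0 -> Y y0 ->
    aX0 < rX < aX1 -> aY0 < rY < aY1 ->
    exists x1 x2 y1 y2 : 'rV[R]_d,
      [/\ (X `&` euclid_ball x0 rX) x1, (X `&` euclid_ball x0 rX) x2,
          (Y `&` euclid_ball y0 rY) y1, (Y `&` euclid_ball y0 rY) y2 &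
          cN * rX * rY <=
            `|Phi x1 y1 - Phi x2 y1 - Phi x1 y2 + Phi x2 y2|].

Definition cis (R : realType) (t : R) : R[i] := (cos t +i* sin t)%C.

Definition cintegral (R : realType) (d : nat)
    (mu : probability (borel_rV R d) R) (D : set 'rV[R]_d)
    (F : 'rV[R]_d -> R[i]) : R[i] :=
  ((\int[mu]_(x in D) complex.Re (F x)) +i*
   (\int[mu]_(x in D) complex.Im (F x)))%C.

(* mu is carried by its support: an element of L^2(mu) is represented by a
   function whose values off supp mu are irrelevant. *)
Definition L2norm (R : realType) (d : nat)
    (mu : probability (borel_rV R d) R) (f : 'rV[R]_d -> R[i]) : \bar R :=
  ('N[mu]_2%:E[EFin \o ((fun x => ComplexField.Normc.normc (f x)) \_ (supp mu))])%E.

Definition inL2 (R : realType) (d : nat)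
    (mu : probability (borel_rV R d) R) (f : 'rV[R]_d -> R[i]) : Prop :=
  [/\ @measurable_fun _ _ (borel_rV R d) R (supp mu)
        (fun x => complex.Re (f x)),
      @measurable_fun _ _ (borel_rV R d) R (supp mu)
        (fun x => complex.Im (f x)) &
      (L2norm mu f < +oo)%E].

Definition L2_opnorm (R : realType) (d : nat)
    (muY muX : probability (borel_rV R d) R)
    (T : ('rV[R]_d -> R[i]) -> 'rV[R]_d -> R[i]) : \bar R :=
  ereal_sup [set L2norm muX (T f) | f in
    [set f | inL2 muY f /\ (L2norm muY f <= 1)%E]].

Definition oscillatory_op (R : realType) (d : nat)
    (Phi : 'rV[R]_d -> 'rV[R]_d -> R) (p : 'rV[R]_d -> 'rV[R]_d -> R[i])
    (h : R) (muY : probability (borel_rV R d) R)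
    (f : 'rV[R]_d -> R[i]) (x : 'rV[R]_d) : R[i] :=
  cintegral muY (supp muY) (fun y => cis (Phi x y / h) * p x y * f y).

(* Main.v *)
Require Import Defs.
From HB Require Import structures.
From mathcomp Require Import all_boot all_order all_algebra.
From mathcomp Require Import complex.
From mathcomp Require Import all_classical all_reals all_analysis.
From mathcomp Require Import measurable_realfun ring lra.
Import Order.TTheory GRing.Theory Num.Theory.
Import numFieldNormedType.Exports.
Set Implicit Arguments.
Unset Strict Implicit.
Unset Printing Implicit Defensive.
Local Open Scope classical_set_scope.
Local Open Scope ring_scope.
Import ComplexField.Normc.

(* Dolgopyat's method. Cut the supports X and Y into nested cells at scales
   L^-k. For a cell J of Y let F_J(x) be the average over J of the integrand,
   twisted by the phase at the center of J; on a cell I of X with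
   |I| |J| ~ h, F_J is bounded, with a Lipschitz constant O(1 / |I|), by some
   m(I, J). Passing from the children of J to J, and from I to its children,
   the Cauchy-Schwarz inequality bounds m(I', J)^2 by the mean A^2 of the
   m(I, J')^2. Nonorthogonality yields two children of I and two children of J
   whose relative phase changes by an amount between tau0 and 1, so the terms
   cannot be aligned on both children of I, and the bound A improves by a
   fixed factor on one of them. Doubling gives that child a fixed share of the
   mass, so the energy (the mean of m^2) shrinks by a factor 1 - eta at each of
   the log(1/h) scales. *)

(** * The modulus of complex numbers *)

(** A step refines X by one level and coarsens Y by one, so the product of the radii keeps its size.
    At this size the part of the phase that couples X and Y stays below one radian: large enough to
    be felt, too small to wrap around. Nonorthogonality speaks of four points only, whereas a gain
    has to hold on a whole cell. This is why every bound controls the size and the Lipschitz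
    constant together, in a ratio [theta]: relative to its bound, such a function is almost constant
    on a cell of X. Each step brings in new oscillation, with the frequency belonging to the coarser
    cell of Y. Refining X by a large factor [L] makes it slow again, with room left for the gain.
    Doubling serves twice: in Y it gives weight to the two misaligned children, in X it gives mass
    to the improved one. No gain is known on the other cells, so a supremum over cells need not
    decay; the mean square does. *)

Section complex_modulus.
Variable R : realType.
Implicit Types (x y z : R[i]) (s t : R).

Lemma le_normc_add x y : normc (x + y) <= normc x + normc y.
Proof. exact: (@le_normcD R x y). Qed.

Lemma normc_opp x : normc (- x) = normc x.
Proof. exact: (@normcN R x). Qed.

Lemma le_normc_sub x y : normc (x - y) <= normc x + normc y.
Proof. by rewrite -(normc_opp y); exact: le_normc_add. Qed.

Lemma normc_ge0 x : 0 <= normc x.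
Proof. by case: x => a b; exact: sqrtr_ge0. Qed.

Lemma sqr_normc_ReIm x : normc x ^+ 2 = complex.Re x ^+ 2 + complex.Im x ^+ 2.
Proof. by case: x => a b /=; rewrite sqr_sqrtr// addr_ge0// sqr_ge0. Qed.

Lemma le_Re_normc x : `|complex.Re x| <= normc x.
Proof.
rewrite -ler_sqr ?nnegrE ?normc_ge0// sqr_normc_ReIm real_normK ?num_real//.
by rewrite lerDl sqr_ge0.
Qed.

Lemma le_Im_normc x : `|complex.Im x| <= normc x.
Proof.
rewrite -ler_sqr ?nnegrE ?normc_ge0// sqr_normc_ReIm real_normK ?num_real//.
by rewrite lerDr sqr_ge0.
Qed.

Lemma normc_le_ReIm x : normc x <= `|complex.Re x| + `|complex.Im x|.
Proof.
rewrite -ler_sqr ?nnegrE ?normc_ge0 ?addr_ge0// sqr_normc_ReIm sqrrD.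
rewrite !real_normK ?num_real// lerD2r lerDl mulrn_wge0//.
Qed.

Lemma normc_real t : normc (t%:C)%C = `|t|.
Proof. by rewrite /= expr0n /= addr0 sqrtr_sqr. Qed.

Lemma le_normc_sum (I : Type) (r : seq I) (P : pred I) (F : I -> R[i]) :
  normc (\sum_(i <- r | P i) F i) <= \sum_(i <- r | P i) normc (F i).
Proof.
elim/big_rec2: _ => [|i s x _ h]; first by rewrite normc0.
by rewrite (le_trans (le_normc_add _ _))// lerD2l.
Qed.

Lemma cisD s t : cis (s + t) = cis s * cis t :> R[i].
Proof.
by apply/eqP; rewrite eq_complex /= sinD cosD eqxx /=; apply/eqP; ring.
Qed.

Lemma cis0 : cis 0 = 1 :> R[i].
Proof. by rewrite /cis cos0 sin0. Qed.

Lemma normc_cis t : normc (cis t) = 1.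
Proof. by rewrite /= cos2Dsin2 sqrtr1. Qed.

Lemma sin_le t : 0 <= t -> `|sin t| <= t.
Proof.
rewrite le_eqVlt => /predU1P[<-|t0]; first by rewrite sin0 normr0.
have [c _] := @MVT R sin cos 0 t t0 (fun r _ => is_derive_sin r)
  (continuous_subspaceT (@continuous_sin R)).
rewrite sin0 !subr0 => ->; rewrite normrM (gtr0_norm t0).
by rewrite ler_piMl ?(ltW t0)// ler_norml cos_geN1 cos_le1.
Qed.

Lemma cos_ge t : 0 <= t -> 1 - t <= cos t.
Proof.
rewrite le_eqVlt => /predU1P[<-|t0]; first by rewrite cos0 subr0.
have [c _] := @MVT R cos (fun r => - sin r) 0 t t0 (fun r _ => is_derive_cos r)
  (continuous_subspaceT (@continuous_cos R)).
rewrite cos0 subr0 => e.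
have : sin c * t <= t by rewrite ler_piMl ?(ltW t0) ?sin_le1.
by move: e; rewrite mulNr; lra.
Qed.

Lemma sin_ge_half t : 0 <= t <= 1 / 2 -> t / 2 <= sin t.
Proof.
rewrite le_eqVlt => /andP[/predU1P[<- _|t0 t2]]; first by rewrite sin0 mul0r.
have [c] := @MVT R sin cos 0 t t0 (fun r _ => is_derive_sin r)
  (continuous_subspaceT (@continuous_sin R)).
rewrite in_itv /= => /andP[c0 ct]; rewrite sin0 !subr0 => ->.
rewrite mulrC ler_wpM2r ?(ltW t0)//.
by apply: le_trans (cos_ge (ltW c0)); lra.
Qed.

Lemma normc_cisB s t : normc (cis s - cis t) = 2 * `|sin ((s - t) / 2)|.
Proof.
have -> : cis s - cis t = (cis (s - t) - 1) * cis t.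
  by rewrite mulrBl mul1r -cisD subrK.
rewrite normcM normc_cis mulr1.
set u := (s - t) / 2.
have -> : s - t = u *+ 2 by rewrite mulr2n /u -splitr.
apply/eqP; rewrite -(@eqrXn2 _ 2)// ?normc_ge0 ?mulr_ge0//; apply/eqP.
rewrite sqr_normc_ReIm exprMn real_normK ?num_real//.
have -> : complex.Re (cis (u *+ 2) - 1) = (cos u ^+ 2 *+ 2) - 1 - 1.
  by rewrite /= cos_mulr2n.
have -> : complex.Im (cis (u *+ 2) - 1) = (cos u * sin u) *+ 2.
  by rewrite /= sin_mulr2n subr0.
have : cos u ^+ 2 = 1 - sin u ^+ 2 by rewrite -(cos2Dsin2 u) addrK.
move: (cos u) (sin u) => c d e.
have -> : ((c * d) *+ 2) ^+ 2 = 4 * c ^+ 2 * d ^+ 2 by ring.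
by rewrite e; ring.
Qed.

Lemma normc_cisB_le s t : normc (cis s - cis t) <= `|s - t|.
Proof.
rewrite normc_cisB; set u := (s - t) / 2.
have -> : s - t = 2 * u by rewrite /u mulrCA divff ?mulr1// pnatr_eq0.
rewrite normrM ger0_norm// ler_wpM2l//.
case: (leP 0 u) => u0; first by rewrite (ger0_norm u0) sin_le.
by rewrite (ltr0_norm u0) -normrN -sinN sin_le// oppr_ge0 ltW.
Qed.

(** The half angle lies in [-1/2, 1/2], where the cosine is at least 1/2. The upper bound on the
    phase keeps it away from full turns, at which the chord vanishes again. *)
Lemma normc_cisB_ge s t : `|s - t| <= 1 ->
  `|s - t| / 2 <= normc (cis s - cis t).
Proof.
rewrite normc_cisB; set u := (s - t) / 2.
have -> : s - t = 2 * u by rewrite /u mulrCA divff ?mulr1// pnatr_eq0.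
rewrite normrM ger0_norm// => h.
suff : `|u| / 2 <= `|sin u| by lra.
have {}h : `|u| <= 1 / 2 by lra.
case: (leP 0 u) => u0.
  rewrite (ger0_norm u0) (le_trans _ (ler_norm _))//.
  by apply: sin_ge_half; rewrite u0 -(ger0_norm u0).
rewrite (ltr0_norm u0) -[X in _ <= X]normrN -sinN (le_trans _ (ler_norm _))//.
by apply: sin_ge_half; rewrite oppr_ge0 (ltW u0) -(ltr0_norm u0).
Qed.

End complex_modulus.

(** * Cancellation between misaligned phases *)

Section variance.
Variables (R : realType) (I : finType) (w : I -> R).
Hypothesis w0 : forall i, 0 <= w i.
Local Notation W := (\sum_i w i).
Hypothesis W0 : 0 < W.

(** The variance identity, not divided by the total weight. Its right side is the deficit in the
    Cauchy-Schwarz inequality, so near equality there forces the values to concentrate at their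
    mean. *)
Lemma sum_sqr_dev (v : I -> R) :
  \sum_i w i * (v i - (\sum_i w i * v i) / W) ^+ 2 =
  \sum_i w i * v i ^+ 2 - (\sum_i w i * v i) ^+ 2 / W.
Proof.
set S := \sum_i w i * v i; set m := S / W.
have Sm : S = m * W by rewrite /m divfK// gt_eqF.
transitivity (\sum_i (w i * v i ^+ 2 - 2 * m * (w i * v i) + m ^+ 2 * w i)).
  by apply: eq_bigr => i _; ring.
rewrite big_split /= sumrB -!mulr_sumr -/S.
have -> : S ^+ 2 / W = m * S by rewrite /m expr2 mulrAC.
by rewrite Sm; ring.
Qed.

Lemma weighted_cauchy (v : I -> R) :
  (\sum_i w i * v i) ^+ 2 <= W * \sum_i w i * v i ^+ 2.
Proof.
rewrite mulrC -ler_pdivrMr// -subr_ge0 -sum_sqr_dev.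
by apply: sumr_ge0 => i _; rewrite mulr_ge0 ?sqr_ge0.
Qed.

Lemma dev_le (v : I -> R) b :
  w b * (v b - (\sum_i w i * v i) / W) ^+ 2 <=
  \sum_i w i * v i ^+ 2 - (\sum_i w i * v i) ^+ 2 / W.
Proof.
rewrite -sum_sqr_dev [leRHS](bigD1 b)//= lerDl.
by apply: sumr_ge0 => i _; rewrite mulr_ge0 ?sqr_ge0.
Qed.

Lemma Re_wsum (z : I -> R[i]) :
  complex.Re (\sum_i (w i)%:C%C * z i) = \sum_i w i * complex.Re (z i).
Proof.
rewrite (big_morph (@complex.Re R) (id1 := 0) (op1 := +%R)) //; last first.
  by move=> [? ?] [? ?].
by apply: eq_bigr => i _; case: (z i) => a b /=; rewrite mul0r subr0.
Qed.

Lemma Im_wsum (z : I -> R[i]) :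
  complex.Im (\sum_i (w i)%:C%C * z i) = \sum_i w i * complex.Im (z i).
Proof.
rewrite (big_morph (@complex.Im R) (id1 := 0) (op1 := +%R)) //; last first.
  by move=> [? ?] [? ?].
by apply: eq_bigr => i _; case: (z i) => a b /=; rewrite mul0r addr0.
Qed.

Lemma complex_dev_le (z : I -> R[i]) b S : S = \sum_i (w i)%:C%C * z i ->
  w b * normc (z b - (W^-1)%:C%C * S) ^+ 2 <=
  \sum_i w i * normc (z i) ^+ 2 - normc S ^+ 2 / W.
Proof.
move=> SE; rewrite !sqr_normc_ReIm mulrDr.
have -> : \sum_i w i * normc (z i) ^+ 2 =
  \sum_i w i * complex.Re (z i) ^+ 2 + \sum_i w i * complex.Im (z i) ^+ 2.
  by rewrite -big_split; apply: eq_bigr => i _; rewrite sqr_normc_ReIm mulrDr.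
have := dev_le (fun i => complex.Re (z i)) b.
have := dev_le (fun i => complex.Im (z i)) b.
rewrite -Re_wsum -Im_wsum -SE mulrDl.
have -> : complex.Re (z b - (W^-1)%:C%C * S) =
  complex.Re (z b) - complex.Re S / W.
  by case: (S) (z b) => ? ? [? ?] /=; rewrite mul0r subr0 [W^-1 * _]mulrC.
have -> : complex.Im (z b - (W^-1)%:C%C * S) =
  complex.Im (z b) - complex.Im S / W.
  by case: (S) (z b) => ? ? [? ?] /=; rewrite mul0r addr0 [W^-1 * _]mulrC.
by lra.
Qed.

End variance.

Section alignment_arithmetic.
Variable R : realFieldType.

Lemma sqr_onem_le (d g : R) : 0 <= d <= 1 -> g * d ^+ 2 <= d ^+ 2 ->
  (1 - d) ^+ 2 <= 1 - g * d ^+ 2.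
Proof. by nra. Qed.

(** The numerical clash that ends the alignment argument: after division by [d * A] the left side is
    at least 31 and the right side at most 7. *)
Lemma alignment_contra (d A : R) : 0 < d -> 64 * d <= 1 -> 0 < A ->
  ~ (32 * d * ((1 - 2 * d) * A) <= 4 * d * A + 2 * ((1 + d) * A * d)).
Proof.
move=> d0 d1 A0; have dA : 0 < d * A by rewrite mulr_gt0.
have : d * (d * A) <= 1 / 64 * (d * A) by rewrite ler_wpM2r ?(ltW dA)//; lra.
by nra.
Qed.

Lemma twisted_diff_split (T : comRingType) (c1 c2 x y u v : T) :
  (c1 - c2) * x = (c1 * x - u) - (c2 * y - v) - c2 * (x - y) + (u - v).
Proof. by ring. Qed.

Lemma subBB (T : zmodType) (x y m : T) : (x - m) - (y - m) = x - y.
Proof. by rewrite opprB addrA subrK. Qed.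

End alignment_arithmetic.

Section alignment.
Variables (R : realType) (I : finType) (w n : I -> R) (G : I -> bool -> R[i]).
Variables (psi : I -> bool -> R) (b1 b2 : I) (A g t : R).
Local Notation W := (\sum_i w i).
Hypotheses (w0 : forall i, 0 <= w i) (n0 : forall i, 0 <= n i) (W0 : 0 < W).
Hypotheses (A0 : 0 <= A) (nA : \sum_i w i * n i ^+ 2 <= W * A ^+ 2).
Hypothesis Gn : forall i e, normc (G i e) <= n i.
Hypotheses (g0 : 0 < g <= 1) (gb1 : g * W <= w b1) (gb2 : g * W <= w b2).
Hypothesis G1 : normc (G b1 true - G b1 false) <= n b1 * (t / 64).
Hypothesis G2 : normc (G b2 true - G b2 false) <= n b2 * (t / 64).
Hypothesis t0 : 0 < t.
Let phase := (psi b1 true - psi b2 true) - (psi b1 false - psi b2 false).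
Hypothesis tphase : t <= `|phase| <= 1.
Let q := 1 - g * (t / 64) ^+ 2.

(* If the phases were almost aligned at both points, then every term of weight
   at least g * W would be close to the mean at both points, which forces the
   two relative phases of b1 and b2 to agree. *)
Lemma misaligned_gain :
  exists e, normc (\sum_i (w i)%:C%C * (cis (psi i e) * G i e)) ^+ 2 <=
            q * (W * A) ^+ 2.
Proof.
have [//|H] := pselect (exists e,
  normc (\sum_i (w i)%:C%C * (cis (psi i e) * G i e)) ^+ 2 <= q * (W * A) ^+ 2).
exfalso; pose S e := \sum_i (w i)%:C%C * (cis (psi i e) * G i e).
pose d := t / 64.
have {}H e : q * (W * A) ^+ 2 < normc (S e) ^+ 2.
  by rewrite ltNge; apply/negP => h; apply: H; exists e.
case/andP: tphase => tp p1; case/andP: g0 => g00 g1.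
have t1 : t <= 1 by exact: le_trans p1.
have d0 : 0 < d by rewrite divr_gt0.
have dt : t = 64 * d by rewrite /d; field.
have d64 : 64 * d <= 1 by rewrite -dt.
have q1 : (1 - d) ^+ 2 <= q.
  rewrite /q -/d; have : g * d ^+ 2 <= d ^+ 2 by rewrite ler_piMl ?sqr_ge0.
  by apply: sqr_onem_le; lra.
have nS e : normc (S e) <= \sum_i w i * n i.
  rewrite (le_trans (le_normc_sum _ _ _))//; apply: ler_sum => i _.
  by rewrite !normcM normc_real normc_cis mul1r ger0_norm// ler_wpM2l.
(* For [A = 0] the weighted sum of the [n i] vanishes, hence so does [S true], against the strict
   inequality [H]. *)
have Apos : 0 < A.
  rewrite lt_neqAle A0 andbT; apply/eqP => A00.
  have := H true; rewrite -A00 mulr0 expr0n mulr0 /=.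
  have : \sum_i w i * n i = 0.
    have := weighted_cauchy w0 W0 n.
    have : \sum_i w i * n i ^+ 2 <=
      0 by rewrite (le_trans nA)// -A00 expr0n mulr0.
    move=> h1 h2; have : (\sum_i w i * n i) ^+ 2 <= 0.
      by rewrite (le_trans h2)// pmulr_rle0.
    by move=> h3; apply/eqP; rewrite -sqrf_eq0 eq_le h3 sqr_ge0.
  have := nS true.
  by move=> /[swap] -> h; rewrite lt_def sqrf_eq0 => /andP[/eqP];
    have := normc_ge0 (S true); lra.
have SA e : (1 - d) * (W * A) <= normc (S e).
  rewrite -ler_sqr ?nnegrE ?normc_ge0 ?mulr_ge0 ?(ltW W0) ?(ltW Apos)//;
    last first.
    by move: d0 d64; lra.
  rewrite exprMn (le_trans _ (ltW (H e)))// ler_wpM2r// sqr_ge0//.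
set N := \sum_i w i * n i in nS.
(* The value of [q] is made for this: the variance is at most (1 - q) W A^2 = g W (d A)^2, so a term
   of weight at least g W lies within d A of the mean. *)
have dev (x v y : R) b : b = b1 \/ b = b2 -> 0 <= x ->
    w b * x ^+ 2 <= y - v ^+ 2 / W -> y <= W * A ^+ 2 ->
      q * (W * A) ^+ 2 <= v ^+ 2 ->
    x <= d * A.
  move=> bb x0 h1 h2 h3.
  have gb : g * W <= w b by case: bb => ->.
  have h4 : q * W * A ^+ 2 <= v ^+ 2 / W.
    by rewrite ler_pdivlMr//; move: h3; rewrite exprMn; congr (_ <= _); ring.
  have h5 : g * W * x ^+ 2 <= g * W * (d * A) ^+ 2.
    apply: (@le_trans _ _ (w b * x ^+ 2)); first by rewrite ler_wpM2r// sqr_ge0.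
    rewrite (le_trans h1)//; have ->
      : g * W * (d * A) ^+ 2 = W * A ^+ 2 - q * W * A ^+ 2.
      by rewrite /q -/d; ring.
    by move: h2 h4; lra.
  move: h5; rewrite ler_pM2l ?mulr_gt0// ler_sqr// nnegrE//
    mulr_ge0 ?(ltW d0)//.
have Wn e : q * (W * A) ^+ 2 <= normc (S e) ^+ 2 by exact: ltW.
have devz e b : b = b1 \/ b = b2 ->
    normc (cis (psi b e) * G b e - (W^-1)%:C%C * S e) <= d * A.
  move=> bb; apply: (dev _ (normc (S e))
    (\sum_i w i * normc (cis (psi i e) * G i e) ^+ 2) b bb) => //.
  - exact: normc_ge0.
  - exact: (complex_dev_le w0 W0 _ erefl).
  - apply: le_trans nA; apply: ler_sum => i _.
    by rewrite ler_wpM2l// normcM normc_cis mul1r ler_sqr ?nnegrE ?normc_ge0.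
have NWA : N <= W * A.
  rewrite -ler_sqr ?nnegrE ?mulr_ge0 ?(ltW W0) ?sumr_ge0//; last first.
    by move=> i _; rewrite mulr_ge0.
  rewrite (le_trans (weighted_cauchy w0 W0 n))// exprMn [W ^+ 2]expr2 -mulrA.
  by rewrite ler_wpM2l ?(ltW W0).
(* The same estimate applies to the bounds [n], because their sum dominates the modulus of [S]. *)
have nb b : b = b1 \/ b = b2 -> n b <= (1 + d) * A.
  move=> bb.
  have h : `|n b - N / W| <= d * A.
    apply: (dev _ N (\sum_i w i * n i ^+ 2) b bb) => //.
      by rewrite real_normK ?num_real//; exact: (dev_le w0 W0 n).
    rewrite (le_trans (Wn true))// ler_sqr ?nnegrE ?normc_ge0//.
    by rewrite sumr_ge0// => i _; rewrite mulr_ge0.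
  have : N / W <= A by rewrite ler_pdivrMr// mulrC.
  by move: h; rewrite ler_norml; lra.
(* Both terms are close to the same mean, which cancels in their difference; only the relative phase
   of [b1] and [b2] is left. *)
have Gpair e : normc (cis (psi b1 e - psi b2 e) * G b1 e - G b2 e) <= 2 * d * A.
  have -> : cis (psi b1 e - psi b2 e) * G b1 e - G b2 e =
    cis (- psi b2 e) * ((cis (psi b1 e) * G b1 e - (W^-1)%:C%C * S e) -
     (cis (psi b2 e) * G b2 e - (W^-1)%:C%C * S e)).
    rewrite subBB.
    by rewrite mulrBr !mulrA -!cisD addNr cis0 mul1r [- _ + _]addrC.
  rewrite normcM normc_cis mul1r (le_trans (le_normc_sub _ _))//.
  by have := devz e b1 (or_introl erefl); have := devz e b2 (or_intror erefl);
    lra.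
have Glow : (1 - 2 * d) * A <= normc (G b1 true).
  have h : (1 - d) * A <= normc ((W^-1)%:C%C * S true).
    rewrite normcM normc_real ger0_norm ?invr_ge0 ?(ltW W0)//
      [leRHS]mulrC ler_pdivlMr//.
    by rewrite (le_trans _ (SA true))// -mulrA [A * _]mulrC.
  have := devz true b1 (or_introl erefl).
  have : normc ((W^-1)%:C%C * S true) <= normc (cis (psi b1 true) * G b1 true) +
      normc (cis (psi b1 true) * G b1 true - (W^-1)%:C%C * S true).
    rewrite -[X in normc X <= _](subKr (cis (psi b1 true) * G b1 true)).
    exact: le_normc_sub.
  rewrite [normc (cis _ * _)]normcM normc_cis mul1r; move: h; lra.
(* [Gpair] at the two values of [e] is compared; by [G1] and [G2], exchanging [true] and [false]
   inside [G] costs at most (1 + d) A d at each of [b1] and [b2]. *)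
have key : normc (cis (psi b1 true - psi b2 true) - cis
  (psi b1 false - psi b2 false))
    * normc (G b1 true) <= 4 * d * A + 2 * ((1 + d) * A * d).
  rewrite -normcM.
  set c1 := cis _; set c2 := cis _.
  have -> : (c1 - c2) * G b1 true = (c1 * G b1 true - G b2 true) -
     (c2 * G b1 false - G b2 false) - c2 * (G b1 true - G b1 false)
     + (G b2 true - G b2 false).
    exact: (twisted_diff_split c1 c2 (G b1 true) (G b1 false) (G b2 true)
      (G b2 false)).
  rewrite (le_trans (le_normc_add _ _))//.
  have h1 := le_normc_sub (c1 *
    G b1 true - G b2 true - (c2 * G b1 false - G b2 false))
      (c2 * (G b1 true - G b1 false)).
  have h2 := le_normc_sub (c1 * G b1 true - G b2 true)
    (c2 * G b1 false - G b2 false).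
  have h3 : normc (c2 * (G b1 true - G b1 false)) <= (1 + d) * A * d.
    rewrite normcM normc_cis mul1r (le_trans G1)// ler_wpM2r ?(ltW d0)//.
    by apply: nb; left.
  have h4 : normc (G b2 true - G b2 false) <= (1 + d) * A * d.
    rewrite (le_trans G2)// ler_wpM2r ?(ltW d0)//.
    by apply: nb; right.
  have := Gpair true; have := Gpair false; rewrite -/c1 -/c2; lra.
have low := normc_cisB_ge p1.
have : 32 * d * ((1 - 2 * d) * A) <= 4 * d * A + 2 * ((1 + d) * A * d).
  rewrite (le_trans _ key)//; apply: ler_pM.
  - by rewrite mulr_ge0// ltW.
  - by rewrite mulr_ge0 ?(ltW Apos)//; move: d64; lra.
  - by rewrite (le_trans _ low)//; move: tp; rewrite dt /phase; lra.
  - exact: Glow.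
by apply: alignment_contra => //; lra.
Qed.

End alignment.

(** * Trees of nets *)

Section nets.
Variables (R : realType) (d N : nat) (c : 'I_N.+1 -> 'rV[R]_d) (r : nat -> R).
Hypothesis r0 : forall k, 0 < r k.

Definition separated (s : R) : pred {set 'I_N.+1} :=
  fun S => [forall x in S, forall y in S, (x != y) ==> (s <= `|c x - c y|)].

Lemma separatedP s (S : {set 'I_N.+1}) :
  reflect (forall x y, x \in S -> y \in S -> x != y -> s <= `|c x - c y|)
          (separated s S).
Proof.
apply: (iffP 'forall_in_forall_inP) => h x.
  by move=> y xS yS xy; have /implyP := h x xS y yS; exact.
by move=> xS y yS; apply/implyP; exact: h.
Qed.

Lemma separated0 s : separated s finset.set0.
Proof. by apply/separatedP => x y; rewrite inE. Qed.

Definition net k : {set 'I_N.+1} := s2val (maxset_exists (separated0 (r k))).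

Lemma netP k : maxset (separated (r k)) (net k).
Proof. by rewrite /net; case: maxset_exists. Qed.

Lemma net_sep k x y : x \in net k -> y \in net k ->
  `|c x - c y| < r k -> x = y.
Proof.
have [/separatedP h _] := maxsetP (netP k).
move=> xk yk; apply: contraTeq => xy; rewrite -leNgt; exact: h.
Qed.

Lemma net_dense k t : exists2 z, z \in net k & `|c t - c z| <= r k.
Proof.
have [sep maxi] := maxsetP (netP k).
have [tk|tk] := boolP (t \in net k).
  by exists t => //; rewrite subrr normr0 ltW.
apply: contrapT => H; have /negP := tk; apply.
rewrite -(maxi (t |: net k)%SET); first by rewrite !inE eqxx.
  apply/separatedP => x y; rewrite !inE => /predU1P[->|xk] /predU1P[->|yk] xy.
  - by rewrite eqxx in xy.
  - by rewrite leNgt; apply/negP => /ltW ?; apply: H; exists y.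
  - rewrite leNgt; apply/negP => /ltW; rewrite distrC => ?; apply: H;
    exists x => //.
  - by move/separatedP : sep; exact.
exact: finset.subsetUr.
Qed.

(* The half radius makes every ball of radius [r k / 2] around a net point flow
   to that point. *)
Definition parent k (t : 'I_N.+1) : 'I_N.+1 :=
  if [pick z in net k | `|c t - c z| < r k / 2] is Some z then z else
  if [pick z in net k | `|c t - c z| <= r k] is Some z then z else t.

Lemma parent_net k t : parent k t \in net k.
Proof.
rewrite /parent; case: pickP => [z /andP[]//|_].
case: pickP => [z /andP[]//|h].
by have [z zk tz] := net_dense k t; have := h z; rewrite zk tz.
Qed.

Lemma parent_dist k t : `|c t - c (parent k t)| <= r k.
Proof.
rewrite /parent; case: pickP => [z /andP[_ /ltW h]|_].
  by apply: le_trans h _; rewrite ler_pdivrMr// ler_peMr ?ltW// ltr1n.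
case: pickP => [z /andP[]//|h].
by have [z zk tz] := net_dense k t; have := h z; rewrite zk tz.
Qed.

Lemma parent_near k t z : z \in net k -> `|c t - c z| < r k / 2 ->
  parent k t = z.
Proof.
move=> zk tz; rewrite /parent; case: pickP => [y /andP[yk ty]|h].
  apply: (net_sep (k := k)) => //.
  have -> : c y - c z = (c t - c z) - (c t - c y) by rewrite opprB [RHS]addrC
    addrA subrK.
  by rewrite (le_lt_trans (ler_normB _ _))// (splitr (r k)) ltrD.
by have := h z; rewrite zk tz.
Qed.

(** The leaves sit one level below [n]: the parents taken are those of levels n, ..., k, and none at
    all for [k = n.+1]. *)
Definition ancestor n k (t : 'I_N.+1) : 'I_N.+1 :=
  foldr (fun j s => parent j s) t (iota k (n.+1 - k)).

Lemma ancestorS n k t : (k <= n)%N ->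
  ancestor n k t = parent k (ancestor n k.+1 t).
Proof. by move=> kn; rewrite /ancestor subSn. Qed.

Lemma ancestor_last n t : ancestor n n.+1 t = t.
Proof. by rewrite /ancestor subnn. Qed.

End nets.

(* [leaf x] is the index of the finest cell containing x (junk off X), [anc k]
   sends it to the index of the level-k cell containing it. *)
Record scale_tree (R : realType) (d : nat) (X : set 'rV[R]_d) (r : nat -> R)
    (n : nat) := ScaleTree {
  leaves : nat ;
  center : 'I_leaves.+1 -> 'rV[R]_d ;
  leaf : 'rV[R]_d -> 'I_leaves.+1 ;
  anc : nat -> 'I_leaves.+1 -> 'I_leaves.+1 ;
  par : nat -> 'I_leaves.+1 -> 'I_leaves.+1 ;
  center_in : forall t, X (center t) ;
  ancE : forall k t, (k < n)%N -> anc k t = par k (anc k.+1 t) ;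
  par_dist : forall k t, (k < n)%N -> `|center t - center (par k t)| <= r k ;
  anc_dist : forall k x, (k <= n)%N -> X x ->
    `|x - center (anc k (leaf x))| <= 2 * r k ;
  anc_ball : forall k t x, (k <= n)%N -> X x ->
    `|x - center (anc k t)| < r k / 4 -> anc k (leaf x) = anc k t ;
  leaf_measurable : forall t,
    measurable ([set x | leaf x = t] : set (borel_rV R d)) }.

Section tree_exists.
Variables (R : realType) (d : nat) (X : set 'rV[R]_d) (r : nat -> R) (n : nat).
Hypotheses (r0 : forall k, 0 < r k) (r8 : forall k, 8 * r k.+1 <= r k).
Hypotheses (cX : compact X) (X0 : X !=set0).

Lemma open_measurable_rV (U : set 'rV[R]_d) :
  open U -> measurable (U : set (borel_rV R d)).
Proof. by move=> oU; exact: sub_sigma_algebra. Qed.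

Lemma measurable_near (z : 'rV[R]_d) (s : R) :
  measurable ([set x | `|x - z| < s] : set (borel_rV R d)).
Proof.
rewrite (_ : [set x | _] = ball z s); last first.
  by rewrite -ball_normE; apply/seteqP; split => x /=; rewrite distrC.
by apply: open_measurable_rV; exact: ball_open.
Qed.

Lemma measurable_find (s : seq 'rV[R]_d) (e : R) i :
  measurable ([set x | find (fun z : 'rV[R]_d => (`|x - z| < e)%R) s = i] : set
    (borel_rV R d)).
Proof.
elim: s i => [i|z s IH i] /=.
  have [<-|i0] := eqVneq 0%N i.
    by rewrite (_ : [set x | _] = setT)//; apply/seteqP.
  rewrite (_ : [set x | _] = set0)//; apply/seteqP; split => // x /= /eqP.
  by rewrite (negPf i0).
case: i => [|i].
  rewrite (_ : [set x | _] = [set x | `|x - z| < e]);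
    first exact: measurable_near.
  by apply/seteqP; split => x /=; case: ifP.
rewrite (_ : [set x | _] = ~` [set x | `|x - z| < e] `&`
   [set x | find (fun z : 'rV[R]_d => (`|x - z| < e)%R) s = i]).
  by apply: measurableI => //; apply: measurableC; exact: measurable_near.
apply/seteqP; split => x /=; case: ifP => //; first by move=> _ [].
  by move=> _ [].
by move=> _ [_ ->].
Qed.

(** A point is sent to the first center in a finite list that is close to it. The order of the list
    makes each fiber a Boolean combination of open balls, hence measurable. *)
Lemma finite_net (e : R) : 0 < e -> exists (N : nat) (c : 'I_N.+1 -> 'rV[R]_d)
    (l : 'rV[R]_d -> 'I_N.+1),
  [/\ forall t, X (c t), forall x, X x -> `|x - c (l x)| < e &
      forall t, measurable ([set x | l x = t] : set (borel_rV R d))].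
Proof.
move=> e0; have := cX; rewrite compact_cover => /(_ _ X (fun z => ball z e)) [].
- by move=> z _; exact: ball_open.
- by move=> x Xx; exists x => //; exact: ballxx.
move=> D DX cov.
have [x0 Xx0] := X0.
pose s : seq 'rV[R]_d := finmap.enum_fset D.
have sX z : z \in s -> X z by move=> zs; apply/set_mem; exact: DX.
have sc x : X x -> has (fun z : 'rV[R]_d => (`|x - z| < e)%R) s.
  move=> /cov[z /= zD]; rewrite -ball_normE /= distrC => xz.
  by apply/hasP; exists z.
have s0 : (0 < size s)%N by have := sc _ Xx0; case: (s).
(* [s] is not empty, so [(size s).-1.+1] is its size. Off X the search may fail and return [size s];
   [inord] then gives a default index. *)
exists (size s).-1, (fun t => s`_t),
  (fun x => inord (find (fun z : 'rV[R]_d => (`|x - z| < e)%R) s)).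
have lt_find x : X x -> (find (fun z : 'rV[R]_d => (`|x - z| < e)%R) s <
  (size s).-1.+1)%N.
  by move=> Xx; rewrite prednK// -has_find; exact: sc.
split.
- by move=> t; apply/sX/mem_nth; move: (ltn_ord t);
  rewrite [X in (_ < X)%N]prednK.
- by move=> x Xx; rewrite inordK ?lt_find//; exact: nth_find (sc x Xx).
- move=> t.
  pose P i := (inord i : 'I_(size s).-1.+1) = t.
  rewrite (_ : [set x | _] = \bigcup_(i in [set i | P i])
      [set x | find (fun z : 'rV[R]_d => (`|x - z| < e)%R) s = i]).
    by apply: bigcup_measurable => i _; exact: measurable_find.
  apply/seteqP; split => [x /= h|x [i Pi /= h]]; last by rewrite h.
  by exists (find (fun z : 'rV[R]_d => (`|x - z| < e)%R) s).
Qed.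

(** By [r8], 2 r(k+1) <= r(k) / 4. This closes the recursion 2 r(k+1) + r(k) <= 2 r(k) for the
    distance to ancestors. It also puts the ancestor at level k+1 of a point of the quarter ball
    within r(k) / 2 of the center, where [parent_near] applies. The leaves are a net at scale
    [r n.+1], so that level [n] has this margin too. *)
Lemma scale_tree_exists : exists T : scale_tree X r n, True.
Proof.
have [N [c [l [cX' lc lm]]]] := finite_net (r0 n.+1).
have dist k x : (k <= n.+1)%N -> X x ->
    `|x - c (ancestor c r n k (l x))| <= 2 * r k.
  move=> kn Xx; rewrite -(subKn kn).
  elim: (n.+1 - k)%N (leq_subr k n.+1) => [|i IH] ik.
    rewrite subn0 ancestor_last (le_trans (ltW (lc x Xx)))//.
    by rewrite ler_peMl ?ler1n// ltW.
  have {}IH := IH (ltnW ik).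
  rewrite ancestorS; last by rewrite leq_subLR addSn ltnS leq_addl.
  rewrite subnSK//; set t := ancestor _ _ _ _ _ in IH *.
  have jS : (n.+1 - i)%N = (n.+1 - i.+1)%N.+1 by rewrite subnSK.
  rewrite (_ : x - _ = (x - c t) + (c t - c (parent c r (n.+1 - i.+1) t)));
    last first.
    by rewrite addrA subrK.
  rewrite (le_trans (ler_normD _ _))//.
  have := parent_dist c r0 (n.+1 - i.+1) t.
  have := r8 (n.+1 - i.+1); have := r0 (n.+1 - i.+1); move: IH; rewrite jS; lra.
have ball k t x : (k <= n)%N -> X x ->
    `|x - c (ancestor c r n k t)| < r k / 4 ->
    ancestor c r n k (l x) = ancestor c r n k t.
  move=> kn Xx; rewrite (ancestorS c r (l x) kn) => h.
  apply: parent_near => //; first by rewrite ancestorS// parent_net.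
  set t' := ancestor c r n k.+1 (l x).
  rewrite (_ : c t' - _ = (c t' - x) + (x - c (ancestor c r n k t)));
    last first.
    by rewrite addrA subrK.
  rewrite (le_lt_trans (ler_normD _ _))//.
  have := dist k.+1 x kn Xx; rewrite -/t' distrC.
  by move: h (r8 k) (r0 k); lra.
have ancP k t : (k < n)%N ->
    ancestor c r n k t = parent c r k (ancestor c r n k.+1 t).
  by move=> kn; rewrite ancestorS// ltnW.
exists (ScaleTree cX' ancP (fun k t _ => parent_dist c r0 k t)
  (fun k x kn => dist k x (leqW kn)) ball lm).
by [].
Qed.

End tree_exists.

(** * One step of the induction on scales *)

Section rV_norms.
Variables (R : realType) (d : nat).

Lemma coord_le_norm (x : 'rV[R]_d) i : `|x 0 i| <= `|x|.
Proof.
rewrite [leRHS]/Num.norm /= mx_normrE.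
exact: (le_bigmax _ (fun ij : 'I_1 * 'I_d => `|x ij.1 ij.2|) (0, i)).
Qed.

Lemma rV_norm_le (x : 'rV[R]_d) s :
  0 <= s -> (forall i, `|x 0 i| <= s) -> `|x| <= s.
Proof.
move=> s0 h; rewrite [leLHS]/Num.norm /= mx_normrE.
by apply: bigmax_le => // -[i j] _ /=; rewrite (ord1 i).
Qed.

Lemma le_euclid_norm (x : 'rV[R]_d) : `|x| <= euclid_norm x.
Proof.
apply: rV_norm_le => [|i]; first exact: sqrtr_ge0.
rewrite -sqrtr_sqr ler_wsqrtr// (bigD1 i)//= lerDl.
by apply: sumr_ge0 => j _; exact: sqr_ge0.
Qed.

End rV_norms.

Section level_sums.
Variables (R : realType) (d : nat) (X : set 'rV[R]_d) (r : nat -> R) (n : nat).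
Variable T : scale_tree X r n.

(** Cells of every level are named by leaf indices, so that all levels share one index type. An
    index that is nobody's ancestor at level [k] gets the empty sum. *)
Definition level_sum (V : nmodType) (m : 'I_(leaves T).+1 -> V) k z : V :=
  \sum_(t | anc k t == z) m t.

Lemma level_sum_par (V : nmodType) (m : 'I_(leaves T).+1 -> V) k z : (k < n)%N
  ->
  level_sum m k z = \sum_(a | par k a == z) level_sum m k.+1 a.
Proof.
move=> kn; rewrite /level_sum
  (partition_big (anc k.+1) (fun a => par k a == z)).
  apply: eq_bigr => a /eqP az; apply: eq_bigl => t.
  rewrite ancE//; have [->|] := eqVneq (anc k.+1 t) a; first by rewrite az eqxx.
  by rewrite andbF.
by move=> t; rewrite ancE.
Qed.

Lemma level_sum_total (V : nmodType) (m : 'I_(leaves T).+1 -> V) k :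
  \sum_z level_sum m k z = \sum_t m t.
Proof.
rewrite [RHS](partition_big (anc k) predT)//=; apply: eq_bigr => z _.
Qed.

Lemma level_sum_ge0 (m : 'I_(leaves T).+1 -> R) k z :
  (forall t, 0 <= m t) -> 0 <= level_sum m k z.
Proof. by move=> m0; exact: sumr_ge0. Qed.

Lemma level_sum_supp (m : 'I_(leaves T).+1 -> R) k z :
  level_sum m k z != 0 -> exists t, anc k t = z.
Proof.
apply: contra_neqP => H; apply: big_pred0 => t.
by apply/negP => /eqP tz; apply: H; exists t.
Qed.

End level_sums.

Lemma cauchy_cond (R : realType) (I : finType) (P : pred I) (w v : I -> R) :
  (forall i, 0 <= w i) ->
  (\sum_(i | P i) w i * v i) ^+ 2 <=
  (\sum_(i | P i) w i) * \sum_(i | P i) w i * v i ^+ 2.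
Proof.
move=> w0; pose w' i := if P i then w i else 0.
have w'0 i : 0 <= w' i by rewrite /w'; case: ifP.
have E (f : I -> R) : \sum_(i | P i) w i * f i = \sum_i w' i * f i.
  by rewrite big_mkcond; apply: eq_bigr => i _; rewrite /w'; case: ifP => // _;
    rewrite mul0r.
have -> : \sum_(i | P i) w i = \sum_i w' i by rewrite big_mkcond.
rewrite !E; have [W0|] := eqVneq (\sum_i w' i) 0; last first.
  by move=> W0; apply: weighted_cauchy => //; rewrite lt_def W0 sumr_ge0.
rewrite W0 mul0r big1 ?expr0n// => i _.
have /eqP := W0; rewrite psumr_eq0// => /allP /(_ i (mem_index_enum i)) /eqP ->.
by rewrite mul0r.
Qed.

Section induction_step.
Variables (R : realType) (d : nat) (X Y : set 'rV[R]_d).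
Variables (Phi : 'rV[R]_d -> 'rV[R]_d -> R) (n : nat) (rX rY : nat -> R).
Variables (TX : scale_tree X rX n) (TY : scale_tree Y rY n).
Variables (mX : 'I_(leaves TX).+1 -> R) (mY : 'I_(leaves TY).+1 -> R).
Variables (u : 'I_(leaves TY).+1 -> 'rV[R]_d -> R[i]).
Variables (h M kap c g L : R).
Hypotheses (mX0 : forall t, 0 <= mX t) (mY0 : forall t, 0 <= mY t).

Local Notation WX k z := (level_sum mX k z).
Local Notation WY j w := (level_sum mY j w).
Definition branch_sum j w x := level_sum (u ^~ x) j w.
(* Removing the phase at the center of the cell leaves a function that varies
   slowly on cells of X at the dual scale. *)
Definition twisted_sum j w x :=
  cis (- (Phi x (center w) / h)) * branch_sum j w x.

(* Bounds on sums rather than averages: no division by the mass, which may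
   vanish. *)
Definition cell_bound (theta : R) k j
  (m : 'I_(leaves TX).+1 -> 'I_(leaves TY).+1 -> R) :=
  forall z w, 0 <= m z w /\ forall x x', X x -> X x' ->
    anc k (leaf TX x) = z -> anc k (leaf TX x') = z ->
    normc (twisted_sum j w x) <= WY j w * m z w /\
    theta * rX k * normc (twisted_sum j w x - twisted_sum j w x') <=
      WY j w * m z w * `|x - x'|.

Definition energy k j (m : 'I_(leaves TX).+1 -> 'I_(leaves TY).+1 -> R) :=
  \sum_z \sum_w WX k z * WY j w * m z w ^+ 2.

Definition mixed_diff (x x' y y' : 'rV[R]_d) :=
  Phi x y - Phi x' y - Phi x y' + Phi x' y'.

Hypotheses (h0 : 0 < h) (M1 : 1 <= M) (c01 : 0 < c <= 1) (g01 : 0 < g <= 1).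
Hypothesis mixed_le : forall x x' y y', X x -> X x' -> Y y -> Y y' ->
  `|mixed_diff x x' y y'| <= M * `|x - x'| * `|y - y'|.
Hypothesis nonorth : nonorthogonal Phi X Y c h h 1 1.
Hypothesis gX : forall k t, (k < n)%N ->
  g * WX k (anc k t) <= WX k.+1 (anc k.+1 t).
Hypothesis gY : forall k t, (k < n)%N ->
  g * WY k (anc k t) <= WY k.+1 (anc k.+1 t).
Hypotheses (rX0 : forall k, 0 < rX k) (rY0 : forall k, 0 < rY k).
Hypotheses (rXL : forall k, rX k.+1 = rX k / L)
  (rYL : forall k, rY k.+1 = rY k / L).
Hypotheses (kap0 : 0 < kap) (kapM : M * kap <= 1).
(** In units of [h], nonorthogonality at a quarter of the radii gives a mixed difference of c kap /
    16, and half of it survives the passage to nearby points and cell centers. [theta] is chosen so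
    that a function within the bounds varies by at most the fraction tau0 / 64 over a distance
    [rX k]. *)
Let tau0 := c * kap / 32.
Let theta := 64 / tau0.
Hypotheses (L16 : 16 <= L) (LM : 512 * M <= c * L)
  (Ltheta : 2 * (theta * M * kap + 1) <= L).
Let q := 1 - g * (tau0 / 64) ^+ 2.

Variables (k j : nat).
Hypotheses (kn : (k < n)%N) (jn : (j < n)%N) (rr : rX k * rY j = kap * h).
Hypotheses (hX : 4 * h < rX k < 4) (hY : 4 * h < rY j < 4).

Let L0 : 0 < L. Proof. by apply: lt_le_trans L16. Qed.
Let tau00 : 0 < tau0.
Proof. by case/andP: c01 => c0 _; rewrite divr_gt0 ?mulr_gt0. Qed.
Let theta0 : 0 < theta. Proof. by rewrite divr_gt0. Qed.
Let M0 : 0 < M. Proof. exact: lt_le_trans M1. Qed.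

Lemma tau0_le : tau0 <= 1 / 32.
Proof.
case/andP: c01 => c0 c1; rewrite /tau0 ler_pM2r ?invr_gt0//.
have kap1 : kap <= 1 by apply: le_trans kapM; rewrite ler_peMl// ltW.
by rewrite -[1]mulr1 ler_pM// ltW.
Qed.

(** The lower bound yields [1 / 2 <= Num.sqrt q]: the Lipschitz estimate improves by the factor 1/2
    only, and it must still hold for the bound improved by the factor sqrt q. *)
Lemma q_bounds : 1 / 4 <= q < 1.
Proof.
case/andP: g01 => g0 g1; have t1 := tau0_le.
have : 0 < g * (tau0 / 64) ^+ 2 by rewrite mulr_gt0// exprn_gt0// divr_gt0.
have : g * (tau0 / 64) ^+ 2 <= 1 * (1 / 64) ^+ 2.
  apply: ler_pM => //; [exact: ltW|exact/ltW/exprn_gt0/divr_gt0|].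
  have t64 : tau0 / 64 <= 1 / 64.
    by rewrite ler_pM2r ?invr_gt0//; apply: le_trans t1 _; lra.
  have t640 : 0 <= tau0 / 64 by rewrite divr_ge0 ?(ltW tau00).
  by rewrite ler_sqr ?nnegrE.
by rewrite /q; lra.
Qed.

(** Each child carries its own reference phase. The change to that of the parent leaves the factors
    whose relative alignment [gain] exploits. *)
Lemma twisted_sum_par w x :
  twisted_sum j w x = \sum_(b | par j b == w)
     cis ((Phi x (center b) - Phi x (center w)) / h) * twisted_sum j.+1 b x.
Proof.
rewrite /twisted_sum /branch_sum level_sum_par// mulr_sumr;
  apply: eq_bigr => b _.
by rewrite mulrA -cisD; congr (cis _ * _); rewrite mulrBl addrAC subrr add0r.
Qed.

Section one_step.
Variable m : 'I_(leaves TX).+1 -> 'I_(leaves TY).+1 -> R.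
Hypothesis mB : cell_bound theta k j.+1 m.

Let parent_bound z w := Num.sqrt
  ((\sum_(b | par j b == w) WY j.+1 b * m z b ^+ 2) / WY j w).

Let WY0 i w : 0 <= WY i w. Proof. exact: level_sum_ge0. Qed.
Let WX0 i w : 0 <= WX i w. Proof. exact: level_sum_ge0. Qed.

Lemma child_energy_ge0 z w : 0 <=
  \sum_(b | par j b == w) WY j.+1 b * m z b ^+ 2.
Proof. by apply: sumr_ge0 => b _; rewrite mulr_ge0 ?sqr_ge0. Qed.

(** This holds for a cell of mass zero as well: its children then have mass zero, so both sides
    vanish. *)
Lemma parent_bound_sqr z w :
  WY j w * parent_bound z w ^+ 2 =
    \sum_(b | par j b == w) WY j.+1 b * m z b ^+ 2.
Proof.
rewrite sqr_sqrtr ?divr_ge0 ?child_energy_ge0//.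
have [W0|W0] := eqVneq (WY j w) 0; last by rewrite mulrC divfK.
rewrite W0 mul0r; apply/esym/big1 => b bw.
have : \sum_(b | par j b == w) WY j.+1 b == 0 by rewrite -level_sum_par// W0.
rewrite psumr_eq0// => /allP /(_ b (mem_index_enum b));
  rewrite bw /= => /eqP ->.
by rewrite mul0r.
Qed.

Lemma parent_bound_ge0 z w : 0 <= parent_bound z w. Proof. exact: sqrtr_ge0.
  Qed.

Lemma child_mean z w : \sum_(b | par j b == w) WY j.+1 b * m z b <=
  WY j w * parent_bound z w.
Proof.
rewrite -ler_sqr ?nnegrE ?mulr_ge0 ?parent_bound_ge0//; last first.
  by apply: sumr_ge0 => b _; rewrite mulr_ge0//; have [] := mB z b.
rewrite (le_trans (cauchy_cond _ _ _))// -parent_bound_sqr -level_sum_par//.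
by rewrite mulrA exprMn expr2.
Qed.

Lemma twisted_sum_sup x w : X x ->
  normc (twisted_sum j w x) <= WY j w * parent_bound (anc k (leaf TX x)) w.
Proof.
move=> Xx; apply: le_trans (child_mean _ _).
rewrite twisted_sum_par (le_trans (le_normc_sum _ _ _))//;
  apply: ler_sum => b _.
by rewrite normcM normc_cis mul1r;
  have [_ /(_ x x Xx Xx erefl erefl) []] := mB (anc k (leaf TX x)) b.
Qed.

(** In units of the new bound, the phases between child and parent centers contribute theta M kap /
    L and the old Lipschitz bounds contribute 1 / L, the radius in X having shrunk by L. [Ltheta]
    makes the sum at most 1/2. *)
Lemma twisted_sum_lip x x' w : X x -> X x' ->
  anc k.+1 (leaf TX x) = anc k.+1 (leaf TX x') ->
  theta * rX k.+1 * normc (twisted_sum j w x - twisted_sum j w x') <=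
  1 / 2 * (WY j w * parent_bound (anc k (leaf TX x)) w) * `|x - x'|.
Proof.
move=> Xx Xx' xx'; set z := anc k _.
have xx : anc k (leaf TX x') = z by rewrite /z !(ancE _ kn) xx'.
have key b : par j b == w ->
  theta * rX k.+1 * normc (cis ((Phi x (center b) - Phi x (center w)) / h) *
    twisted_sum j.+1 b x -
     cis ((Phi x' (center b) - Phi x' (center w)) / h) * twisted_sum j.+1 b x')
       <=
  WY j.+1 b * m z b * (1 / 2 * `|x - x'|).
  move=> bw; set s := _ / h; set s' := (Phi x' _ - _) / h.
  have [mzb0 /(_ x x' Xx Xx' erefl xx)[h1 h2]] := mB z b.
  have -> : cis s * twisted_sum j.+1 b x - cis s' * twisted_sum j.+1 b x' =
     (cis s - cis s') * twisted_sum j.+1 b x +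
       cis s' * (twisted_sum j.+1 b x - twisted_sum j.+1 b x').
    by rewrite mulrBl mulrBr addrA subrK.
  have ss : normc (cis s - cis s') <= M * `|x - x'| * rY j / h.
    rewrite (le_trans (normc_cisB_le _ _))//
      /s /s' -mulrBl normrM (gtr0_norm (_ : 0 < h^-1)) ?invr_gt0//.
    rewrite ler_wpM2r ?invr_ge0 ?(ltW h0)//.
    have := mixed_le Xx Xx' (center_in b) (center_in w).
    rewrite /mixed_diff (_ : Phi x _ - _ - _ + _ =
      Phi x (center b) - Phi x (center w) -
        (Phi x' (center b) - Phi x' (center w))); last by ring.
    move=> /le_trans; apply; rewrite ler_wpM2l ?mulr_ge0 ?(ltW M0)//.
    by rewrite -(eqP bw) par_dist.
  have a1 : normc ((cis s - cis s') * twisted_sum j.+1 b x) <=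
      (M * `|x - x'| * rY j / h) * (WY j.+1 b * m z b).
    by rewrite normcM ler_pM// ?normc_ge0.
  have a2 : normc (cis s' * (twisted_sum j.+1 b x - twisted_sum j.+1 b x')) <=
    normc (twisted_sum j.+1 b x - twisted_sum j.+1 b x').
    by rewrite normcM normc_cis mul1r.
  set B := WY j.+1 b * m z b in h1 h2 a1 *.
  have B0 : 0 <= B by rewrite mulr_ge0.
  have tr0 : 0 < theta * rX k.+1 by rewrite mulr_gt0.
  rewrite (le_trans (ler_wpM2l (ltW tr0) (le_normc_add _ _)))//.
  rewrite mulrDr (le_trans (lerD (ler_wpM2l (ltW tr0) a1)
    (ler_wpM2l (ltW tr0) a2)))//.
  have e1 : theta * rX k.+1 * (M * `|x - x'| * rY j / h * B) =
      theta * M * kap / L * (B * `|x - x'|).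
    rewrite rXL; transitivity
      (theta * M * (rX k * rY j) / (L * h) * (B * `|x - x'|)).
      by field; rewrite !gt_eqF.
    by rewrite rr; field; rewrite !gt_eqF.
  have e2 : theta * rX k.+1 *
    normc (twisted_sum j.+1 b x - twisted_sum j.+1 b x') <=
      1 / L * (B * `|x - x'|).
    rewrite rXL (_ : theta * _ * _ =
      (theta * rX k * normc (twisted_sum j.+1 b x - twisted_sum j.+1 b x')) /
        L); last first.
      by field; rewrite gt_eqF.
    by rewrite mulrC mul1r ler_wpM2l// invr_ge0 ltW.
  rewrite e1 (le_trans (lerD (lexx _) e2))// -mulrDl.
  rewrite [leRHS](_ : _ = 1 / 2 * (B * `|x - x'|)); last by ring.
  rewrite ler_wpM2r ?mulr_ge0// -mulrDl ler_pdivrMr//; move: Ltheta; lra.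
rewrite !twisted_sum_par -sumrB.
have tr0 : 0 <= theta * rX k.+1 by rewrite mulr_ge0 ?(ltW theta0)
  ?(ltW (rX0 _)).
rewrite (le_trans (ler_wpM2l tr0 (le_normc_sum _ _ _)))// mulr_sumr.
rewrite (le_trans (ler_sum _ key))// -mulr_suml.
rewrite [leRHS](_ : _ = WY j w * parent_bound z w * (1 / 2 * `|x - x'|));
  last by ring.
by rewrite ler_wpM2r ?mulr_ge0//; exact: child_mean.
Qed.


Lemma mixed_perturb x1 x2 y1 y2 x1' x2' y1' y2' e f :
  X x1 -> X x2 -> X x1' -> X x2' -> Y y1 -> Y y2 -> Y y1' -> Y y2' ->
  `|x1 - x1'| <= e * rX k -> `|x2 - x2'| <= e * rX k ->
  `|y1 - y1'| <= f * rY j -> `|y2 - y2'| <= f * rY j ->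
  `|y1 - y2| <= rY j -> `|x1' - x2'| <= rX k ->
  `|mixed_diff x1 x2 y1 y2| <= `|mixed_diff x1' x2' y1' y2'| +
     2 * M * (e + f) * (rX k * rY j).
Proof.
move=> X1 X2 X1' X2' Y1 Y2 Y1' Y2' dx1 dx2 dy1 dy2 dy dx.
have -> : mixed_diff x1 x2 y1 y2 =
  mixed_diff x1' x2' y1' y2' + mixed_diff x1 x1' y1 y2
  - mixed_diff x2 x2' y1 y2 +
    mixed_diff x1' x2' y1 y1' - mixed_diff x1' x2' y2 y2'.
  by rewrite /mixed_diff; ring.
have le v v' a b : X v -> X v' -> Y a -> Y b -> forall s t,
  `|v - v'| <= s * rX k ->
    `|a - b| <= t * rY j -> `|mixed_diff v v' a b| <=
      M * (s * t) * (rX k * rY j).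
  move=> Xv Xv' Ya Yb s t vs vt; apply: le_trans (mixed_le Xv Xv' Ya Yb) _.
  rewrite [leRHS](_ : _ = M * (s * rX k) * (t * rY j)); last by ring.
  by rewrite ler_pM ?mulr_ge0 ?(ltW M0)// ler_wpM2l ?(ltW M0).
have b1 := le _ _ _ _ X1 X1' Y1 Y2 e 1 dx1; rewrite mul1r in b1;
  have {}b1 := b1 dy.
have b2 := le _ _ _ _ X2 X2' Y1 Y2 e 1 dx2; rewrite mul1r in b2;
  have {}b2 := b2 dy.
have b3 := le _ _ _ _ X1' X2' Y1 Y1' 1 f; rewrite mul1r in b3;
  have {}b3 := b3 dx dy1.
have b4 := le _ _ _ _ X1' X2' Y2 Y2' 1 f; rewrite mul1r in b4;
  have {}b4 := b4 dx dy2.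
rewrite mulr1 in b1 b2; rewrite mul1r in b3 b4.
rewrite (le_trans (ler_normB _ _))//
  (le_trans (lerD (ler_normD _ _) (lexx _)))//.
rewrite (le_trans (lerD (lerD (ler_normB _ _) (lexx _)) (lexx _)))//.
rewrite (le_trans (lerD (lerD (lerD (ler_normD _ _) (lexx _)) (lexx _))
  (lexx _)))//.
move: b1 b2 b3 b4; rewrite !mulrDr !mulrDl; lra.
Qed.

(** The candidates are the children of z containing the points [x1], [x2] of a nonorthogonal
    quadruple; [anc_ball] and [gX] give them the right parent and enough mass. If both failed, each
    would contain a point where the bound fails. These points are still misaligned, [L] being large,
    and [misaligned_gain] gives the contradiction. *)
Lemma gain z w : 0 < WX k z -> 0 < WY j w ->
  exists a, [/\ par k a = z, g * WX k z <= WX k.+1 a &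
    forall x, X x -> anc k.+1 (leaf TX x) = a ->
      normc (twisted_sum j w x) <= WY j w * (Num.sqrt q * parent_bound z w)].
Proof.
move=> Wz Ww; apply: contrapT => no.
have [t tz] : exists t, anc k t = z by apply: (level_sum_supp (m := mX));
  rewrite gt_eqF.
have [s sw] : exists s, anc j s = w by apply: (level_sum_supp (m := mY));
  rewrite gt_eqF.
case/andP: (hX) => hX1 hX2; case/andP: (hY) => hY1 hY2.
(* Points within a quarter of the radius of a center belong to its cell, by [anc_ball]; the bounds
   4h and 4 on the radii put these quarters in the range of nonorthogonality. *)
have nX : h < rX k / 4 < 1 by lra.
have nY : h < rY j / 4 < 1 by lra.
have [x1 [x2 [y1 [y2 []]]]] := nonorth (center_in z) (center_in w) nX nY.
move=> [X1 e1] [X2 e2] [Y1 f1] [Y2 f2] big.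
have {}e1 : `|x1 - center z| < rX k / 4 := le_lt_trans (le_euclid_norm _) e1.
have {}e2 : `|x2 - center z| < rX k / 4 := le_lt_trans (le_euclid_norm _) e2.
have {}f1 : `|y1 - center w| < rY j / 4 := le_lt_trans (le_euclid_norm _) f1.
have {}f2 : `|y2 - center w| < rY j / 4 := le_lt_trans (le_euclid_norm _) f2.
have ax v : X v -> `|v - center z| < rX k / 4 -> anc k (leaf TX v) = z.
  by move=> Xv; rewrite -tz => ?; apply: anc_ball => //; exact: ltnW.
have ay v : Y v -> `|v - center w| < rY j / 4 -> anc j (leaf TY v) = w.
  by move=> Xv; rewrite -sw => ?; apply: anc_ball => //; exact: ltnW.
have pick v : X v -> `|v - center z| < rX k / 4 -> exists v', [/\ X v',
    anc k.+1 (leaf TX v') = anc k.+1 (leaf TX v) &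
    WY j w * (Num.sqrt q * parent_bound z w) < normc (twisted_sum j w v')].
  move=> Xv vz; apply: contrapT => H'; apply: no;
    exists (anc k.+1 (leaf TX v)); split.
  - by rewrite -ancE//; exact: ax.
  - by rewrite -(ax v Xv vz); exact: gX.
  - move=> x Xx xa; rewrite leNgt; apply/negP => h1; apply: H'; by exists x.
have [x1' [X1' a1 n1]] := pick _ X1 e1.
have [x2' [X2' a2 n2]] := pick _ X2 e2.
have rXk0 := rX0 k; have rYj0 := rY0 j.
have distX v v' : X v -> X v' -> anc k.+1 (leaf TX v') = anc k.+1 (leaf TX v) ->
    `|v - v'| <= 4 / L * rX k.
  move=> Xv Xv' vv'.
  rewrite (le_trans (ler_distD (center (anc k.+1 (leaf TX v))) _ _))//.
  rewrite [X in _ + X]distrC.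
  have := anc_dist TX kn Xv; have := anc_dist TX kn Xv'; rewrite vv' rXL.
  by rewrite -[4 / L * _]mulrA [L^-1 * _]mulrC; lra.
have L16' : 4 / L <= 1 / 4 by rewrite ler_pdivrMr//; move: L16; lra.
have dX1 := distX _ _ X1 X1' a1; have dX2 := distX _ _ X2 X2' a2.
have dXs : 4 / L * rX k <= 1 / 4 * rX k by rewrite ler_wpM2r// ltW.
have dx : `|x1' - x2'| <= rX k.
  have := ler_distD x1 x1' x2'; have := ler_distD (center z) x1 x2'.
  have := ler_distD x2 (center z) x2';
    rewrite (distrC x1' x1) (distrC (center z) x2).
  by lra.
set b1 := anc j.+1 (leaf TY y1); set b2 := anc j.+1 (leaf TY y2).
have bw1 : par j b1 == w by rewrite /b1 -ancE// ay.
have bw2 : par j b2 == w by rewrite /b2 -ancE// ay.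
have Wb1 : g * WY j w <= WY j.+1 b1 by rewrite -(eqP bw1) -ancE//; exact: gY.
have Wb2 : g * WY j w <= WY j.+1 b2 by rewrite -(eqP bw2) -ancE//; exact: gY.
have dY1 : `|y1 - center b1| <= 2 / L * rY j.
  by have := anc_dist TY jn Y1; rewrite rYL -mulrA [L^-1 * _]mulrC.
have dY2 : `|y2 - center b2| <= 2 / L * rY j.
  by have := anc_dist TY jn Y2; rewrite rYL -mulrA [L^-1 * _]mulrC.
have dY : `|y1 - y2| <= rY j.
  by have := ler_distD (center w) y1 y2; rewrite (distrC (center w) y2); lra.
have dc : `|center b1 - center b2| <= rY j.
  have : 2 / L * rY j <= 1 / 8 * rY j by rewrite ler_wpM2r ?(ltW rYj0)//
    ler_pdivrMr//; move: L16; lra.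
  have := ler_distD y1 (center b1) (center b2);
    have := ler_distD (center w) y1 (center b2).
  have := ler_distD y2 (center w) (center b2);
    rewrite (distrC (center b1) y1) (distrC (center w) y2).
  by lra.
have pert := mixed_perturb X1 X2 X1' X2' Y1 Y2 (center_in b1) (center_in b2)
  dX1 dX2 dY1 dY2 dY dx.
set D := mixed_diff x1' x2' (center b1) (center b2) in pert.
have rr0 : 0 < rX k * rY j by rewrite mulr_gt0.
(* The displacements 4/L in X and 2/L in Y cost 12 M / L, which [LM] keeps below c / 32, half of the
   initial c / 16. *)
have Dlow : tau0 * h <= `|D|.
  have : 2 * M * (4 / L + 2 / L) * (rX k * rY j) <= c / 32 * (rX k * rY j).
    rewrite ler_wpM2r ?(ltW rr0)//.
    have -> : 2 * M * (4 / L + 2 / L) = 12 * M / L by field; rewrite gt_eqF.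
    by rewrite ler_pdivrMr//; move: LM; have := M0; lra.
  move: big pert; rewrite -/(mixed_diff x1 x2 y1 y2).
  have -> : c * (rX k / 4) * (rY j / 4) = c / 16 * (rX k * rY j) by field.
  have -> : tau0 * h = c / 32 * (rX k * rY j) by rewrite rr /tau0; field.
  have : 0 < c / 32 * (rX k * rY j) by rewrite mulr_gt0// divr_gt0//;
    case/andP: c01.
  lra.
(* Here [M * kap <= 1] keeps the relative phase [D / h] within one radian. *)
have Dup : `|D| <= 1 * h.
  rewrite (le_trans (mixed_le X1' X2' (center_in b1) (center_in b2)))//.
  apply: (@le_trans _ _ (M * (rX k * rY j))).
    by rewrite -mulrA ler_wpM2l ?(ltW M0)// ler_pM.
  by rewrite rr mulrA ler_wpM2r// ltW.
(* [misaligned_gain] sums over all indices, so cells outside w get weight 0. [G] is the mean over a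
   child; at weight 0 it is 0, in agreement with [twisted_sum], which is bounded by a multiple of
   the weight. *)
pose wt b := if par j b == w then WY j.+1 b else 0.
pose G b (e : bool) := ((wt b)^-1)%:C%C *
  (if par j b == w then twisted_sum j.+1 b (if e then x1' else x2') else 0).
pose psi (b : 'I_(leaves TY).+1) (e : bool) := let x :=
  if e then x1' else x2' in (Phi x (center b) - Phi x (center w)) / h.
have wt0 b : 0 <= wt b by rewrite /wt; case: ifP.
have Ewt (f : 'I_(leaves TY).+1 -> R) : \sum_b wt b * f b =
  \sum_(b | par j b == w) WY j.+1 b * f b.
  by rewrite [RHS]big_mkcond; apply: eq_bigr => b _; rewrite /wt;
    case: ifP => // _; rewrite mul0r.
have Wsum : \sum_b wt b = WY j w by rewrite /wt -big_mkcond level_sum_par.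
have z1 : anc k (leaf TX x1') = z by rewrite (ancE _ kn) a1 -(ancE _ kn) ax.
have z2 : anc k (leaf TX x2') = z by rewrite (ancE _ kn) a2 -(ancE _ kn) ax.
have Hle b (e : bool) : par j b == w ->
  normc (twisted_sum j.+1 b (if e then x1' else x2')) <= wt b * m z b.
  move=> bw; rewrite /wt bw; have [_ hb] := mB z b.
  by case: e; [have [] := hb _ _ X1' X1' z1 z1|have [] := hb _ _ X2' X2' z2 z2].
have wG b e : (wt b)%:C%C * G b e = if par j b ==
  w then twisted_sum j.+1 b (if e then x1' else x2') else 0.
  rewrite /G mulrA -rmorphM/=; have [wb|wb] := eqVneq (wt b) 0.
    rewrite wb mul0r mul0r; case: ifP => // bw; have := Hle b e bw.
    rewrite wb mul0r => n0; apply/esym; apply: eq0_normc; apply/eqP.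
    by rewrite eq_le n0 normc_ge0.
  by rewrite mulfV// mul1r.
have HG e : \sum_b (wt b)%:C%C * (cis (psi b e) * G b e) =
  twisted_sum j w (if e then x1' else x2').
  rewrite twisted_sum_par [RHS]big_mkcond; apply: eq_bigr => b _;
    rewrite mulrCA wG.
  by case: ifP => // _; rewrite mulr0.
have m0 b : 0 <= m z b by have [] := mB z b.
have tau : (psi b1 true - psi b2 true) - (psi b1 false - psi b2 false) = D / h.
  by rewrite /psi /D /mixed_diff /=; ring.
have Gn b e : normc (G b e) <= m z b.
  have [wb|wb] := eqVneq (wt b) 0; first by rewrite /G wb invr0 mul0r normc0.
  have wb0 : 0 < wt b by rewrite lt_def wb wt0.
  rewrite /G normcM normc_real ger0_norm ?invr_ge0// mulrC ler_pdivrMr// mulrC.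
  by case: ifP => bw; [exact: Hle|rewrite normc0 mulr_ge0].
(* [x1'] and [x2'] are at distance at most [rX k], so the Lipschitz bound leaves a variation of at
   most m / theta = m tau0 / 64. *)
have GD b : par j b == w -> g * WY j w <= WY j.+1 b ->
    normc (G b true - G b false) <= m z b * (tau0 / 64).
  move=> bw gb; have wb : wt b = WY j.+1 b by rewrite /wt bw.
  have wb0 : 0 < wt b.
    by rewrite wb (lt_le_trans _ gb)// mulr_gt0//; case/andP: g01.
  rewrite /G bw -mulrBr normcM normc_real ger0_norm ?invr_ge0//.
  rewrite mulrC ler_pdivrMr//.
  have [_ /(_ x1' x2' X1' X2' z1 z2)[_]] := mB z b; rewrite -wb => hl.
  have : theta * rX k * normc (twisted_sum j.+1 b x1' - twisted_sum j.+1 b x2')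
    <= wt b * m z b * rX k.
    by rewrite (le_trans hl)// ler_wpM2l// mulr_ge0.
  rewrite mulrAC ler_pM2r// mulrC -ler_pdivlMr// /theta invf_div.
  by move=> /le_trans; apply; rewrite le_eqVlt; apply/orP; left; apply/eqP;
    ring.
have phase : tau0 <= `|(psi b1 true - psi b2 true) -
  (psi b1 false - psi b2 false)| <= 1.
  by rewrite tau normrM (gtr0_norm (_ : 0 < h^-1)) ?invr_gt0// ler_pdivlMr//
    ler_pdivrMr// Dlow.
have Wt : 0 < \sum_b wt b by rewrite Wsum.
have nA : \sum_b wt b * m z b ^+ 2 <= (\sum_b wt b) * parent_bound z w ^+ 2.
  by rewrite Ewt Wsum parent_bound_sqr.
have gb1 : g * (\sum_b wt b) <= wt b1 by rewrite Wsum /wt bw1.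
have gb2 : g * (\sum_b wt b) <= wt b2 by rewrite Wsum /wt bw2.
have [e] := misaligned_gain wt0 m0 Wt (parent_bound_ge0 z w) nA Gn g01 gb1 gb2
  (GD b1 bw1 Wb1) (GD b2 bw2 Wb2) tau00 phase.
rewrite HG Wsum -/q; apply/negP; rewrite -ltNge.
have q0 : 0 <= q by have /andP[] := q_bounds; lra.
have -> : q * (WY j w * parent_bound z w) ^+ 2 =
  (WY j w * (Num.sqrt q * parent_bound z w)) ^+ 2.
  by rewrite !exprMn (sqr_sqrtr q0) mulrCA.
rewrite ltr_sqr ?nnegrE ?normc_ge0 ?mulr_ge0 ?parent_bound_ge0 ?sqrtr_ge0//.
by case: (e).
Qed.

(* Only the cell singled out by [gain] improves; its share of the mass is at
   least [g], whence the factor. *)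
Lemma energy_step : exists m', cell_bound theta k.+1 j m' /\
  energy k.+1 j m' <= (1 - (1 - q) * g) * energy k j.+1 m.
Proof.
pose gains a w := forall x, X x -> anc k.+1 (leaf TX x) = a ->
      normc (twisted_sum j w x) <=
        WY j w * (Num.sqrt q * parent_bound (par k a) w).
(* The improved value is taken wherever it holds, so no child has to be selected; [gain] enters only
   in the estimate of the energy. *)
pose m' a w := if `[< gains a w >] then Num.sqrt q *
  parent_bound (par k a) w else parent_bound (par k a) w.
have /andP[q14 q1] := q_bounds.
have q0 : 0 <= q by lra.
have sq12 : 1 / 2 <= Num.sqrt q.
  rewrite -ler_sqr ?nnegrE ?sqrtr_ge0 ?divr_ge0// (sqr_sqrtr q0).
  by apply: le_trans q14; lra.
have sq1 : Num.sqrt q <= 1 by rewrite -sqrtr1 ler_wsqrtr// ltW.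
exists m'; split.
  move=> a w; split.
    by rewrite /m'; case: ifP => _;
      rewrite ?mulr_ge0 ?parent_bound_ge0 ?sqrtr_ge0.
  move=> x x' Xx Xx' xa xa'.
  have px : anc k (leaf TX x) = par k a by rewrite (ancE _ kn) xa.
  split.
    rewrite /m'; case: asboolP => [|_]; first by apply.
    by rewrite -px; exact: twisted_sum_sup.
  rewrite (le_trans (twisted_sum_lip w Xx Xx' _)) ?xa ?xa'//.
  rewrite ler_wpM2r// mulrCA ler_wpM2l// px /m'.
  by case: ifP => _; [rewrite ler_wpM2r ?parent_bound_ge0|rewrite ler_piMl
    ?parent_bound_ge0//; lra].
have key z w : \sum_(a | par k a == z) WX k.+1 a * WY j w * m' a w ^+ 2 <=
    (1 - (1 - q) * g) * (WX k z * \sum_(b | par j b == w) WY j.+1 b *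
      m z b ^+ 2).
  rewrite -parent_bound_sqr.
  have m'A a : par k a == z -> m' a w ^+ 2 <= parent_bound z w ^+ 2.
    move=> /eqP az; rewrite /m' az; case: ifP => // _.
    by rewrite exprMn (sqr_sqrtr q0) ler_piMl ?sqr_ge0// ltW.
  have [W0|W0] := eqVneq (WX k z) 0.
    rewrite W0 mul0r mulr0 big1// => a az.
    have : \sum_(a | par k a == z) WX k.+1 a ==
      0 by rewrite -level_sum_par// W0.
    rewrite psumr_eq0// => /allP /(_ a (mem_index_enum a));
      rewrite az /= => /eqP ->.
    by rewrite !mul0r.
  have [V0|V0] := eqVneq (WY j w) 0.
    by rewrite V0 mul0r !mulr0 big1// => a _; rewrite mulr0 mul0r.
  have [a [/eqP az ga ha]] : exists a,
    [/\ par k a = z, g * WX k z <= WX k.+1 a & gains a w].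
    have [|| a [az ga ha]] := @gain z w;
      [by rewrite lt_def W0 WX0|by rewrite lt_def V0 WY0|].
    by exists a; split => // x Xx xa; rewrite az; exact: ha.
  have WYA0 : 0 <= WY j w * parent_bound z w ^+ 2 by rewrite mulr_ge0// sqr_ge0.
  rewrite (bigD1 a)//=.
  have e1 : WX k.+1 a * WY j w * m' a w ^+ 2 =
    q * (WX k.+1 a * (WY j w * parent_bound z w ^+ 2)).
    by rewrite /m'; case: asboolP => // _;
      rewrite (eqP az) exprMn (sqr_sqrtr q0); ring.
  have e2 : \sum_(i | (par k i == z) && (i != a)) WX k.+1 i * WY j w *
    m' i w ^+ 2 <=
      (WX k z - WX k.+1 a) * (WY j w * parent_bound z w ^+ 2).
    rewrite [in leRHS]level_sum_par// (bigD1 a az)/=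
      addrAC subrr add0r mulr_suml.
    apply: ler_sum => i /andP[iz _]; rewrite mulrA ler_wpM2l ?mulr_ge0//.
    exact: m'A.
  rewrite e1 (le_trans (lerD (lexx _) e2))//.
  have : g * WX k z * (WY j w * parent_bound z w ^+ 2) * (1 - q) <=
    WX k.+1 a * (WY j w * parent_bound z w ^+ 2) * (1 - q).
    by rewrite ler_wpM2r ?subr_ge0 ?(ltW q1)// ler_wpM2r.
  move: (WX k z) (WX k.+1 a) (WY j w * parent_bound z w ^+ 2) => P Q V; lra.
rewrite /energy.
rewrite (partition_big (par k) predT)//= mulr_sumr; apply: ler_sum => z _.
rewrite exchange_big /=.
have -> : \sum_w WX k z * WY j.+1 w * m z w ^+ 2 =
    \sum_w WX k z * \sum_(b | par j b == w) WY j.+1 b * m z b ^+ 2.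
  rewrite -mulr_sumr (partition_big (par j) predT)//= mulr_sumr.
  apply: eq_bigr => w _; rewrite mulr_sumr; apply: eq_bigr => b _;
    by rewrite mulrA.
by rewrite mulr_sumr; apply: ler_sum => w _; exact: key.
Qed.


End one_step.
End induction_step.

(** Meant for the integrals [f1] of |f| and [f2] of |f|^2 over cells of mass [w]: the Cauchy-Schwarz
    inequality on each cell passes to unions. Where [w] vanishes, so does [f1]. *)
Lemma cauchy_pairs (R : realType) (I : finType) (P : pred I) (f1 f2 w : I -> R)
  :
  (forall i, 0 <= w i) -> (forall i, 0 <= f2 i) ->
  (forall i, f1 i ^+ 2 <= w i * f2 i) ->
  (\sum_(i | P i) f1 i) ^+ 2 <= (\sum_(i | P i) w i) * \sum_(i | P i) f2 i.
Proof.
move=> w0 f20 f12; pose v i := f1 i / w i.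
have wv i : w i * v i = f1 i.
  rewrite /v; have [wi|wi] := eqVneq (w i) 0; last by rewrite mulrC divfK.
  rewrite wi mul0r; apply/esym/eqP; rewrite -sqrf_eq0 eq_le sqr_ge0 andbT.
  by rewrite (le_trans (f12 i))// wi mul0r.
have -> : \sum_(i | P i) f1 i = \sum_(i | P i) w i * v i.
  by apply: eq_bigr => i _; rewrite wv.
rewrite (le_trans (cauchy_cond _ _ w0))//.
rewrite ler_wpM2l ?sumr_ge0//; apply: ler_sum => i _.
rewrite expr2 mulrA wv /v; have [wi|wi] := eqVneq (w i) 0.
  by rewrite wi invr0 !mulr0.
by rewrite mulrA -expr2 ler_pdivrMr ?lt_def ?wi ?w0// mulrC.
Qed.

(** * Iteration over the pairs of dual levels *)

Section iteration.
Variables (R : realType) (d : nat) (X Y : set 'rV[R]_d).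
Variables (Phi : 'rV[R]_d -> 'rV[R]_d -> R) (n : nat) (rX rY : nat -> R).
Variables (TX : scale_tree X rX n) (TY : scale_tree Y rY n).
Variables (mX : 'I_(leaves TX).+1 -> R) (mY : 'I_(leaves TY).+1 -> R).
Variables (u : 'I_(leaves TY).+1 -> 'rV[R]_d -> R[i]).
Variables (h M kap c g L : R).
Hypotheses (mX0 : forall t, 0 <= mX t) (mY0 : forall t, 0 <= mY t).
Hypotheses (h0 : 0 < h) (M1 : 1 <= M) (c01 : 0 < c <= 1) (g01 : 0 < g <= 1).
Hypothesis mixed_le : forall x x' y y', X x -> X x' -> Y y -> Y y' ->
  `|mixed_diff Phi x x' y y'| <= M * `|x - x'| * `|y - y'|.
Hypothesis nonorth : nonorthogonal Phi X Y c h h 1 1.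
Hypothesis gX : forall k t, (k < n)%N ->
  g * level_sum mX k (anc k t) <= level_sum mX k.+1 (anc k.+1 t).
Hypothesis gY : forall k t, (k < n)%N ->
  g * level_sum mY k (anc k t) <= level_sum mY k.+1 (anc k.+1 t).
Hypotheses (rX0 : forall k, 0 < rX k) (rY0 : forall k, 0 < rY k).
Hypotheses (rXL : forall k, rX k.+1 = rX k / L)
  (rYL : forall k, rY k.+1 = rY k / L).
Hypotheses (kap0 : 0 < kap) (kapM : M * kap <= 1).
Let tau0 := c * kap / 32.
Let theta := 64 / tau0.
(** One factor [g] comes from the weight of the misaligned children in Y, through [q]; the other is
    the share of the improved child in X. *)
Let eta := g ^+ 2 * (tau0 / 64) ^+ 2.
Hypotheses (L16 : 16 <= L) (LM : 512 * M <= c * L)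
  (Ltheta : 2 * (theta * M * kap + 1) <= L).
Hypothesis rr : forall k, (k < n)%N -> rX k * rY (n.-1 - k)%N = kap * h.
Hypothesis hX : forall k, (k < n)%N -> 4 * h < rX k < 4.
Hypothesis hY : forall k, (k < n)%N -> 4 * h < rY k < 4.
Hypotheses (mX1 : \sum_t mX t = 1) (mY1 : \sum_t mY t = 1).
Variables (f1 f2 : 'I_(leaves TY).+1 -> R) (P K : R).
Hypotheses (f10 : forall t, 0 <= f1 t) (f20 : forall t, 0 <= f2 t).
Hypothesis f12 : forall t, f1 t ^+ 2 <= mY t * f2 t.
Hypotheses (P0 : 0 <= P) (K0 : 0 <= K).
Hypothesis uP : forall t x, X x -> normc (u t x) <= P * f1 t.
Hypothesis uK : forall t w x x', X x -> X x' -> anc n t = w ->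
  normc (cis (- (Phi x (center w) / h)) * u t x -
         cis (- (Phi x' (center w) / h)) * u t x') <= K * `|x - x'| * f1 t.

Let C0 := P + theta * rX 0 * K.
(** The quadratic mean of f over the cell w, since only its square is known to be integrable. [C0]
    covers both the size and the Lipschitz constant of the kernel. *)
Let m0 (z : 'I_(leaves TX).+1) w :=
  C0 * Num.sqrt (level_sum f2 n w / level_sum mY n w).

Let theta0 : 0 < theta.
Proof. by case/andP: c01 => c0 _; rewrite !divr_gt0 ?mulr_gt0. Qed.

Let C00 : 0 <= C0.
Proof. by rewrite addr_ge0// mulr_ge0// mulr_ge0// ltW. Qed.

Lemma f1_level w : level_sum f1 n w <=
  level_sum mY n w * Num.sqrt (level_sum f2 n w / level_sum mY n w).
Proof.
have s1 := level_sum_ge0 n w f10; have s2 := level_sum_ge0 n w f20.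
have s0 := level_sum_ge0 n w mY0.
rewrite -ler_sqr ?nnegrE ?mulr_ge0 ?sqrtr_ge0//.
rewrite (le_trans (cauchy_pairs _ mY0 f20 f12))// exprMn sqr_sqrtr ?divr_ge0//.
rewrite -/(level_sum mY n w) -/(level_sum f2 n w).
have [->|W0] := eqVneq (level_sum mY n w) 0;
  first by rewrite mul0r expr0n mul0r.
by rewrite expr2 -mulrA (mulrCA _ (level_sum f2 n w)) mulfV// mulr1.
Qed.

Lemma base_bound : cell_bound Phi mY u h theta 0 n m0.
Proof.
move=> z w; split; first by rewrite mulr_ge0 ?sqrtr_ge0.
move=> x x' Xx Xx' _ _; have fw := f1_level w.
set S := level_sum mY n w * Num.sqrt _ in fw.
have S0 : 0 <= S by rewrite mulr_ge0 ?sqrtr_ge0// level_sum_ge0.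
have -> : level_sum mY n w * m0 z w = C0 * S by rewrite /m0 /S mulrCA.
split.
  rewrite /twisted_sum normcM normc_cis mul1r (le_trans (le_normc_sum _ _ _))//.
  apply: (@le_trans _ _ (P * S)).
    apply: le_trans (ler_wpM2l P0 fw); rewrite mulr_sumr.
    by apply: ler_sum => t _; exact: uP.
  by rewrite ler_wpM2r// lerDl mulr_ge0// mulr_ge0// ltW.
rewrite /twisted_sum /branch_sum /level_sum !mulr_sumr -sumrB.
have tr0 : 0 <= theta * rX 0 by rewrite mulr_ge0// ltW.
rewrite (le_trans (ler_wpM2l tr0 (le_normc_sum _ _ _)))//.
apply: (@le_trans _ _ (theta * rX 0 * (K * `|x - x'| * S))).
  rewrite ler_wpM2l//; apply: le_trans
    (ler_wpM2l (mulr_ge0 K0 (normr_ge0 _)) fw).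
  by rewrite mulr_sumr; apply: ler_sum => t /eqP tw; exact: uK.
rewrite [leLHS](_ : _ = theta * rX 0 * K * (S * `|x - x'|)); last by ring.
rewrite -(mulrA C0); apply: ler_wpM2r; first exact: (mulr_ge0 S0).
by rewrite /C0 lerDr.
Qed.

Lemma base_energy : energy mX mY 0 n m0 <= C0 ^+ 2 * \sum_t f2 t.
Proof.
rewrite /energy -[leRHS]mul1r -mX1 -(level_sum_total mX 0) mulr_suml.
apply: ler_sum => z _; rewrite -(level_sum_total f2 n) !mulr_sumr.
apply: ler_sum => w _; rewrite /m0 -mulrA ler_wpM2l ?level_sum_ge0//.
have s2 := level_sum_ge0 n w f20; have s0 := level_sum_ge0 n w mY0.
rewrite exprMn sqr_sqrtr ?divr_ge0// mulrCA ler_wpM2l ?sqr_ge0//.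
have [->|W0] := eqVneq (level_sum mY n w) 0; first by rewrite mul0r.
by rewrite mulrCA mulfV// mulr1.
Qed.

(** Each step trades a level of Y for a level of X, from (k, n - k) to (k + 1, n - k - 1). The
    duality [rr] is imposed on the two parents involved, at levels k in X and n - k - 1 in Y. *)
Lemma iterate k : (k <= n)%N -> exists m,
  cell_bound Phi mY u h theta k (n - k) m /\
  energy mX mY k (n - k) m <= (1 - eta) ^+ k * (C0 ^+ 2 * \sum_t f2 t).
Proof.
elim: k => [_|k IH kn].
  by exists m0; rewrite subn0 expr0 mul1r; split;
    [exact: base_bound|exact: base_energy].
have [m [mb me]] := IH (ltnW kn).
have e : (n - k)%N = (n - k.+1).+1 by rewrite subnSK.
have e' : (n - k.+1)%N = (n.-1 - k)%N by rewrite -[in RHS]subn1 subnAC subn1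
  subnS.
have jn : (n - k.+1 < n)%N by rewrite ltn_subrL/= (leq_ltn_trans _ kn).
rewrite e in mb me.
have rrk : rX k * rY (n - k.+1)%N = kap * h by rewrite e' rr.
have [m' [mb' me']] := energy_step mX0 mY0 h0 M1 c01 g01 mixed_le nonorth gX gY
  rX0 rY0 rXL rYL kap0 kapM L16 LM Ltheta kn jn rrk (hX kn) (hY jn) mb.
exists m'; split => //; apply: le_trans me' _.
rewrite (_ : 1 - (1 - _) * g = 1 - eta); last by rewrite /eta -/tau0; ring.
rewrite exprS -mulrA ler_wpM2l//.
have /andP[] := q_bounds M1 c01 g01 kap0 kapM; rewrite -/tau0 /eta => h1 h2.
case/andP: g01 => g0 g1.
rewrite subr_ge0 expr2 -mulrA; apply: mulr_ile1 => //; first exact: ltW.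
  by rewrite mulr_ge0 ?sqr_ge0// ltW.
by move: h1; lra.
Qed.

(** At the pair (n, 0) the twists are dropped, being of modulus 1. The few coarse cells of Y are
    summed by the Cauchy-Schwarz inequality with total mass 1, and the mean of [phi] is exactly the
    energy. *)
Lemma finite_bound : exists phi : 'I_(leaves TX).+1 -> R,
  [/\ forall t, 0 <= phi t,
      forall x, X x -> normc (\sum_t u t x) ^+ 2 <= phi (leaf TX x) &
      \sum_t mX t * phi t <= (1 - eta) ^+ n * (C0 ^+ 2 * \sum_t f2 t)].
Proof.
have [m [mb me]] := iterate (leqnn n); rewrite subnn in mb me.
exists (fun t => \sum_w level_sum mY 0 w * m (anc n t) w ^+ 2); split.
- by move=> t; apply: sumr_ge0 => w _; rewrite mulr_ge0 ?sqr_ge0 ?level_sum_ge0.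
- move=> x Xx; set z := anc n _.
  have m00 w : 0 <= m z w by have [] := mb z w.
  apply: (@le_trans _ _ ((\sum_w level_sum mY 0 w * m z w) ^+ 2)).
    rewrite ler_sqr ?nnegrE ?normc_ge0 ?sumr_ge0//; last first.
      by move=> w _; rewrite mulr_ge0 ?level_sum_ge0.
    rewrite -(level_sum_total (u ^~ x) 0) (le_trans (le_normc_sum _ _ _))//.
    apply: ler_sum => w _; have [_ /(_ x x Xx Xx erefl erefl) []] := mb z w.
    by rewrite /twisted_sum normcM normc_cis mul1r.
  apply: le_trans (cauchy_cond _ _ _) _ => [w|]; first exact: level_sum_ge0.
  by rewrite level_sum_total mY1 mul1r.
- apply: le_trans me; rewrite /energy (partition_big (anc n) predT)//=.
  apply: ler_sum => z _; rewrite le_eqVlt; apply/orP; left; apply/eqP.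
  rewrite /level_sum -/(level_sum mX n z).
  transitivity (\sum_(t | anc n t == z) mX t * \sum_w level_sum mY 0 w *
    m z w ^+ 2).
    by apply: eq_bigr => t /eqP ->.
  rewrite -mulr_suml -/(level_sum mX n z) mulr_sumr.
  by apply: eq_bigr => w _; rewrite mulrA.
Qed.

End iteration.

(** * Calculus on boxes *)

Section epsilon_delta.
Variables (R : realType).

Lemma within_continuousP (V W : normedModType R) (A : set V) (f : V -> W) :
  {within A, continuous f} <->
  (forall x, A x -> forall e, 0 < e -> exists2 e', 0 < e' &
     forall y, A y -> `|x - y| < e' -> `|f x - f y| < e).
Proof.
split=> [/subspace_continuousP h x Ax e e0|h].
  have /cvgrPdist_lt/(_ e e0) := h x Ax.
  rewrite near_withinE => /nbhs_ballP[e' /= e'0 H]; exists e' => // y Ay xy.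
  by apply: H => //; rewrite -ball_normE.
apply/subspace_continuousP => x Ax; apply/cvgrPdist_lt => e e0.
rewrite near_withinE; have [e' e'0 H] := h x Ax e e0.
apply/nbhs_ballP; exists e' => //= y; rewrite -ball_normE /= => xy Ay.
exact: H.
Qed.

Lemma within_continuous_comp (V1 V2 W : normedModType R) (A : set V1)
  (B : set V2)
    (f : V2 -> W) (rho : V1 -> V2) (C : R) :
  (forall x y, `|rho x - rho y| <= C * `|x - y|) ->
  (forall x, A x -> B (rho x)) ->
  {within B, continuous f} -> {within A, continuous (f \o rho)}.
Proof.
move=> rhoC AB /within_continuousP cf; apply/within_continuousP => x Ax e e0.
have [e' e'0 H] := cf _ (AB _ Ax) e e0.
have C0 : 0 < `|C| + 1 by rewrite ltr_wpDl.
exists (e' / (`|C| + 1)); first by rewrite divr_gt0.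
move=> y Ay; rewrite ltr_pdivlMr// => xy; apply: H; first exact: AB.
apply: le_lt_trans xy; rewrite (le_trans (rhoC _ _))// mulrC ler_wpM2l//.
by rewrite (le_trans (ler_norm _))// lerDl.
Qed.

Lemma within_dnbhs0P (D : set R) (F : R -> R) (l : R) :
  (F @ within D 0^' --> l) <->
  (forall e, 0 < e -> exists2 e', 0 < e' &
     forall t, t != 0 -> D t -> `|t| < e' -> `|l - F t| < e).
Proof.
split=> [h e e0|h].
  have /cvgrPdist_lt/(_ e e0) := h.
  rewrite !near_withinE => /nbhs_ballP[e' /= e'0 H]; exists e' => // t t0 Dt te.
  by apply: H => //; rewrite -ball_normE /= sub0r normrN.
apply/cvgrPdist_lt => e e0; rewrite !near_withinE; have [e' e'0 H] := h e e0.
apply/nbhs_ballP; exists e' => //= t; rewrite -ball_normE /= sub0r normrN.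
by move=> te t0 Dt; exact: H.
Qed.

Lemma compact_normed_bound (V W : normedModType R) (K : set V) (f : V -> W) :
  compact K -> {within K, continuous f} ->
  exists2 B, 0 <= B & forall x, K x -> `|f x| <= B.
Proof.
move=> cK cf; have [M [Mr MB]] := compact_bounded (continuous_compact cf cK).
exists (`|M| + 1); first by rewrite addr_ge0.
move=> x Kx; apply: (MB (`|M| + 1)); last by exists x.
by rewrite (le_lt_trans (ler_norm _))// ltrDl.
Qed.

End epsilon_delta.

Section box_calculus.
Variables (R : realType) (n : nat) (c : 'rV[R]_n).
Local Notation K := (unit_box c).

Lemma unit_box_closed : closed K.
Proof.
rewrite (_ : K = \bigcap_(i in [set: 'I_n])
   ((fun x : 'rV[R]_n => x 0 i) @^-1` `[c 0 i, c 0 i + 1])); last first.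
  apply/seteqP; split => [x h i _|x h i]; first by rewrite /= in_itv /=;
    exact: h.
  by have := h i I; rewrite /= in_itv.
apply: closed_bigI => i _; apply: closed_comp; last exact: itv_closed.
by move=> x _; exact: coord_continuous.
Qed.

Lemma unit_box_compact : compact K.
Proof.
apply: bounded_closed_compact unit_box_closed.
exists (`|c| + 1); split; first exact: num_real.
move=> M cM x Kx; apply: le_trans (ltW cM).
apply: rV_norm_le; first by rewrite addr_ge0.
move=> i; have /andP[h1 h2] := Kx i; have := coord_le_norm c i.
by rewrite !ler_norml => /andP[h3 h4]; apply/andP; split; lra.
Qed.

Lemma delta_coord (i j : 'I_n) (t : R) : (t *: delta_mx 0 i : 'rV[R]_n) 0 j =
  t * (j == i)%:R.
Proof. by rewrite !mxE eqxx. Qed.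

Lemma delta_norm (i : 'I_n) (t : R) : `|t *: delta_mx 0 i : 'rV[R]_n| <= `|t|.
Proof.
apply: rV_norm_le => // j; rewrite delta_coord; case: eqP => _.
  by rewrite mulr1.
by rewrite mulr0 normr0.
Qed.

Lemma box_segment (x : 'rV[R]_n) i s t : K x -> K (x + s *: delta_mx 0 i) ->
  0 <= t <= s -> K (x + t *: delta_mx 0 i).
Proof.
move=> Kx Ks /andP[t0 ts] j; have := Kx j; have := Ks j.
rewrite !mxE eqxx /=; case: eqP => _ /=;
  rewrite ?mulr1 ?mulr0 => /andP[h1 h2] /andP[h3 h4].
  by apply/andP; split; lra.
by apply/andP.
Qed.

(** Inside the segment small increments of both signs stay in [K], so the derivative relative to [K]
    is an ordinary one there and the mean value theorem applies, even along a face of the box. *)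
Lemma partial_le_pos (f : 'rV[R]_n -> R) (g : 'rV[R]_n -> R) i B x s :
  {within K, continuous f} ->
  (forall x, K x -> is_partial_within K f i x (g x)) ->
  (forall x, K x -> `|g x| <= B) ->
  K x -> K (x + s *: delta_mx 0 i) -> 0 <= s ->
  `|f (x + s *: delta_mx 0 i) - f x| <= B * s.
Proof.
move=> cf pf gB Kx Ks; rewrite le_eqVlt => /predU1P[<-|s0].
  by rewrite scale0r addr0 subrr normr0 mulr0.
pose phi t := f (x + t *: delta_mx 0 i).
have cphi : {within `[0, s], continuous phi}.
  apply: (@within_continuous_comp R R _ R _ K f
    (fun t => x + t *: delta_mx 0 i) 1) => //.
    move=> t t'; rewrite opprD addrACA subrr add0r -scalerBl mul1r.
    exact: delta_norm.
  by move=> t; rewrite /= in_itv /=; exact: box_segment.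
have dphi t : t \in `]0, s[ -> is_derive t 1 phi (g (x + t *: delta_mx 0 i)).
  rewrite in_itv /= => /andP[t0 ts].
  have Kt : K (x + t *: delta_mx 0 i) by apply: box_segment Ks _ => //;
    rewrite !ltW.
  have cv : h^-1 *: ((phi \o shift t) (h *: 1) - phi t) @[h --> 0^'] -->
    g (x + t *: delta_mx 0 i).
    apply/cvgrPdist_lt => e e0; rewrite near_withinE.
    have /within_dnbhs0P/(_ e e0)[e' e'0 H] := pf _ Kt.
    apply/nbhs_ballP; exists (Order.min e' (Order.min t (s - t))).
      by rewrite /= !lt_min e'0 t0 subr_gt0.
    move=> y; rewrite -ball_normE /= sub0r normrN !lt_min =>
      /and3P[y1 y2 y3] y0.
    have E : x + (y *: (1 : R) + t) *: delta_mx 0 i =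
      x + t *: delta_mx 0 i + y *: delta_mx 0 i.
      by rewrite [y *: 1]mulr1 [y + t]addrC scalerDl addrA.
    have := H y y0; rewrite /phi /= E; apply => //=.
    rewrite -E; apply: box_segment Ks _ => //; rewrite [y *: 1]mulr1.
    move: y2 y3; rewrite !ltr_norml => /andP[? ?] /andP[? ?]; apply/andP;
      split; lra.
  apply: DeriveDef; first by apply/cvg_ex; eexists; exact: cv.
  by rewrite /derive; apply: cvg_lim => //; exact: cv.
have [t t0s] := MVT s0 dphi cphi.
rewrite /phi scale0r addr0 subr0 => ->;
  rewrite normrM (gtr0_norm s0) ler_wpM2r ?(ltW s0)//.
apply: gB; apply: box_segment Ks _ => //.
by move: t0s; rewrite in_itv /= => /andP[? ?]; rewrite !ltW.
Qed.

Lemma partial_le (f : 'rV[R]_n -> R) (g : 'rV[R]_n -> R) i B x s :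
  {within K, continuous f} ->
  (forall x, K x -> is_partial_within K f i x (g x)) ->
  (forall x, K x -> `|g x| <= B) ->
  K x -> K (x + s *: delta_mx 0 i) ->
  `|f (x + s *: delta_mx 0 i) - f x| <= B * `|s|.
Proof.
move=> cf pf gB Kx Ks; case: (leP 0 s) => s0.
  by rewrite (ger0_norm s0) (partial_le_pos cf pf gB).
rewrite distrC (ltr0_norm s0).
have := @partial_le_pos f g i B (x + s *: delta_mx 0 i) (- s) cf pf gB Ks.
by rewrite scaleNr addrK; apply => //; rewrite oppr_ge0 ltW.
Qed.

(** The coordinates of x are replaced by those of y one at a time; the intermediate points stay in
    the set because it is a box. *)
Lemma box_lipschitz (f : 'rV[R]_n -> R) (g : 'I_n -> 'rV[R]_n -> R) B x y :
  {within K, continuous f} ->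
  (forall i x, K x -> is_partial_within K f i x (g i x)) ->
  (forall i x, K x -> `|g i x| <= B) -> 0 <= B ->
  K x -> K y -> `|f y - f x| <= n%:R * B * `|y - x|.
Proof.
move=> cf pf gB B0 Kx Ky.
pose w k : 'rV[R]_n := \row_i (if (i < k)%N then y 0 i else x 0 i).
have Kw k : K (w k) by move=> i; rewrite mxE; case: ifP.
have w0 : w 0%N = x by apply/rowP => i; rewrite mxE.
have wn : w n = y by apply/rowP => i; rewrite mxE ltn_ord.
suff H k : (k <= n)%N -> `|f (w k) - f x| <= k%:R * (B * `|y - x|).
  by have := H n (leqnn n); rewrite wn mulrA.
elim: k => [_|k IH kn]; first by rewrite w0 subrr normr0 mul0r.
rewrite (le_trans (ler_distD (f (w k)) _ _))// mulrSr mulrDl mul1r addrC.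
rewrite lerD ?IH ?(ltnW kn)//.
pose i := Ordinal kn; pose s := y 0 i - x 0 i.
have ws : w k.+1 = w k + s *: delta_mx 0 i.
  apply/rowP => j; rewrite mxE [in RHS]mxE delta_coord mxE ltnS leq_eqVlt.
  have -> : (val j == k) = (j == i) by [].
  have [->|ji] := eqVneq j i; first by rewrite /= ltnn mulr1 /s addrC subrK.
  by rewrite mulr0 addr0.
rewrite ws (le_trans (partial_le cf (pf i) (gB i) (Kw k) _)) -?ws//.
rewrite ler_wpM2l//; have := coord_le_norm (y - x) i.
by rewrite !mxE.
Qed.

Lemma C1_lipschitz (f : 'rV[R]_n -> R) : C_on 1 K f ->
  exists2 B, 0 <= B & forall x y, K x -> K y -> `|f y - f x| <= B * `|y - x|.
Proof.
move=> [cf [g /= gP]].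
have : forall i, exists B, 0 <= B /\ forall x, K x -> `|g i x| <= B.
  move=> i; have [_ [cg _]] := gP i.
  by have [B B0 h] := compact_normed_bound unit_box_compact cg; exists B.
move=> /choice[B BP].
exists (n%:R * \sum_i B i).
  by rewrite mulr_ge0// sumr_ge0// => i _; have [] := BP i.
move=> x y; apply: (@box_lipschitz f g) => //.
- by move=> i z; have [h _] := gP i; exact: h.
- move=> i z Kz; have [_ h] := BP i;
  rewrite (le_trans (h z Kz))// (bigD1 i)//= lerDl.
  by rewrite sumr_ge0// => j _; have [] := BP j.
- by rewrite sumr_ge0// => i _; have [] := BP i.
Qed.

Lemma C_onW k (f : 'rV[R]_n -> R) : C_on k.+1 K f -> C_on k K f.
Proof.
elim: k f => [f [cf _]//|k IH f [cf [g gP]]]; split => //.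
by exists g => i; have [h1 h2] := gP i; split => //; exact: IH.
Qed.

End box_calculus.

Section product_box.
Variables (R : realType) (d : nat) (a b : 'rV[R]_d).
Local Notation K := (prod_rV (unit_box a) (unit_box b)).

Lemma prod_unit_box : K = unit_box (row_mx a b).
Proof.
apply/seteqP; split => z.
  move=> [h1 h2] i; rewrite -(splitK i); case: (fintype.split i) => j /=.
    by rewrite row_mxEl; have := h1 j; rewrite mxE.
  by rewrite row_mxEr; have := h2 j; rewrite mxE.
move=> h; split => j; rewrite mxE.
  by have := h (lshift d j); rewrite row_mxEl.
by have := h (rshift d j); rewrite row_mxEr.
Qed.

Lemma row_mx_norm_l (u : 'rV[R]_d) : `|row_mx u 0 : 'rV[R]_(d + d)| <= `|u|.
Proof.
apply: rV_norm_le => // i; rewrite -(splitK i); case: (fintype.split i) => j /=.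
  by rewrite row_mxEl coord_le_norm.
by rewrite row_mxEr mxE normr0.
Qed.

Lemma row_mx_norm_r (u : 'rV[R]_d) : `|row_mx 0 u : 'rV[R]_(d + d)| <= `|u|.
Proof.
apply: rV_norm_le => // i; rewrite -(splitK i); case: (fintype.split i) => j /=.
  by rewrite row_mxEl mxE normr0.
by rewrite row_mxEr coord_le_norm.
Qed.

Lemma row_mx_distl (x x' y : 'rV[R]_d) : `|row_mx x y - row_mx x' y| <=
  `|x - x'|.
Proof. by rewrite opp_row_mx add_row_mx subrr row_mx_norm_l. Qed.

Lemma row_mx_distr (x y y' : 'rV[R]_d) : `|row_mx x y - row_mx x y'| <=
  `|y - y'|.
Proof. by rewrite opp_row_mx add_row_mx subrr row_mx_norm_r. Qed.

Lemma prod_rV_row (x y : 'rV[R]_d) : unit_box a x -> unit_box b y ->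
  K (row_mx x y).
Proof. by move=> ax ay; split; rewrite ?row_mxKl ?row_mxKr. Qed.

Variable F : 'rV[R]_d -> 'rV[R]_d -> R.
Local Notation f := (fun z : 'rV[R]_(d + d) => F (lsubmx z) (rsubmx z)).

Lemma C1_lipschitz_l : C_on 1 K f -> exists2 B, 0 <= B &
  forall x x' y, unit_box a x -> unit_box a x' -> unit_box b y ->
    `|F x y - F x' y| <= B * `|x - x'|.
Proof.
rewrite prod_unit_box => /C1_lipschitz[B B0 h]; exists B => // x x' y ax ax' yb.
have := h (row_mx x' y) (row_mx x y);
  rewrite -prod_unit_box !row_mxKl !row_mxKr.
move=> /(_ (prod_rV_row ax' yb) (prod_rV_row ax yb)) /le_trans; apply.
by rewrite ler_wpM2l// row_mx_distl.
Qed.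

Lemma C0_bounded : C_on 0 K f -> exists2 B, 0 <= B &
  forall x y, unit_box a x -> unit_box b y -> `|F x y| <= B.
Proof.
rewrite prod_unit_box => -[cf _].
have [B B0 h] := compact_normed_bound (@unit_box_compact _ _ _) cf.
exists B => // x y ax yb; have := h (row_mx x y).
by rewrite -prod_unit_box row_mxKl row_mxKr; apply; exact: prod_rV_row.
Qed.

Lemma continuous_r (x : 'rV[R]_d) : {within K, continuous f} -> unit_box a x ->
  {within unit_box b, continuous (F x)}.
Proof.
move=> cf ax; have -> : F x = f \o (fun y => row_mx x y).
  by apply/funext => y /=; rewrite row_mxKl row_mxKr.
apply: (within_continuous_comp (C := 1)) cf => [y y'|y yb];
  last exact: prod_rV_row.
by rewrite mul1r row_mx_distr.
Qed.

(** For fixed y and y', the partial derivatives of F(., y) - F(., y') are differences of first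
    derivatives of F, hence of order |y - y'|. The Lipschitz bound in x then gives the product. The
    1 added to the constant normalizes it to [1 <= B]. *)
Lemma C2_mixed : C_on 2 K f -> exists2 B, 1 <= B &
  forall x x' y y', unit_box a x -> unit_box a x' -> unit_box b y ->
    unit_box b y' ->
    `|mixed_diff F x x' y y'| <= B * `|x - x'| * `|y - y'|.
Proof.
rewrite prod_unit_box => -[cf [g gP]].
have : forall i, exists B, 0 <= B /\ forall z z', K z -> K z' ->
   `|g i z' - g i z| <= B * `|z' - z|.
  move=> i; have [_ Cg] := gP i; have [B B0 h] := C1_lipschitz Cg.
  by exists B; rewrite prod_unit_box.
move=> /choice[B BP].
have B0 i : 0 <= B i by have [] := BP i.
have S0 : 0 <= \sum_i B i by apply: sumr_ge0.
exists (d%:R * \sum_i B i + 1); first by rewrite lerDr mulr_ge0.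
move=> x x' y y' ax ax' yb yb'.
apply: (@le_trans _ _ (d%:R * (\sum_i B i * `|y - y'|) * `|x - x'|));
  last first.
  rewrite -mulr_suml mulrDl mul1r mulrDl.
  rewrite [leLHS](_ : _ = d%:R * (\sum_i B i) * `|x - x'| * `|y - y'|);
    last by ring.
  by rewrite lerDl mulr_ge0.
pose G v := F v y - F v y'.
have -> : mixed_diff F x x' y y' = G x - G x' by rewrite /mixed_diff /G; ring.
pose gG i v := g (lshift d i) (row_mx v y) - g (lshift d i) (row_mx v y').
apply: (@box_lipschitz _ _ a G gG) => //.
- have cr z : unit_box b z -> {within unit_box a, continuous (F ^~ z)}.
    move=> bz; have -> : F ^~ z = f \o (fun v => row_mx v z).
      by apply/funext => v /=; rewrite row_mxKl row_mxKr.
    rewrite -prod_unit_box in cf.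
    apply: (within_continuous_comp (C := 1)) cf => [v v'|v va];
      last exact: prod_rV_row.
    by rewrite mul1r row_mx_distl.
  by move=> v; apply: cvgB; [exact: cr|exact: cr].
- move=> i v av.
  have pd z : unit_box b z ->
      is_partial_within (unit_box a) (F ^~ z) i v (g (lshift d i) (row_mx v z)).
    move=> bz; have [h _] := gP (lshift d i).
    have := h (row_mx v z); rewrite -prod_unit_box => /(_ (prod_rV_row av bz)).
    have E t : row_mx v z + t *: delta_mx 0 (lshift d i) =
      row_mx (v + t *: delta_mx 0 i) z.
      have -> : delta_mx 0 (lshift d i) =
        row_mx (delta_mx 0 i) 0 :> 'rV[R]_(d + d).
        apply/rowP => j; rewrite -(splitK j); case: (fintype.split j) => k /=.
          by rewrite row_mxEl !mxE /= eq_lshift.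
        by rewrite row_mxEr !mxE /= eq_rlshift.
      by rewrite scale_row_mx scaler0 add_row_mx addr0.
    rewrite /is_partial_within.
    under eq_fun do rewrite E !row_mxKl !row_mxKr.
    rewrite (_ : [set t | K _] =
      [set t | unit_box a (v + t *: delta_mx 0 i)])//.
    apply/seteqP; split => t /=; rewrite E.
      by move=> [/=]; rewrite row_mxKl.
    by move=> at'; exact: prod_rV_row.
  rewrite /is_partial_within /gG.
  have -> : (fun t : R => t^-1 * (G (v + t *: delta_mx 0 i) - G v)) =
     (fun t : R => t^-1 * (F (v + t *: delta_mx 0 i) y - F v y)) \-
     (fun t : R => t^-1 * (F (v + t *: delta_mx 0 i) y' - F v y')).
    by apply/funext => t /=; rewrite /G; ring.
  by apply: cvgB; exact: pd.
- move=> i v av; rewrite /gG.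
  have [_ h] := BP (lshift d i).
  have := h _ _ (prod_rV_row av yb') (prod_rV_row av yb) => /le_trans; apply.
  rewrite -mulr_suml.
  apply: (@le_trans _ _ (B (lshift d i) * `|y - y'|));
    first by rewrite ler_wpM2l// row_mx_distr.
  rewrite ler_wpM2r// (bigD1 (lshift d i))//= lerDl.
  exact: sumr_ge0.
- by apply: sumr_ge0 => i _; rewrite mulr_ge0.
Qed.

End product_box.

(** * Complex-valued integrals *)

Section cells.
Context {disp : measure_display} {T : measurableType disp} {R : realType}.
Variables (mu : probability T R) (Y : set T) (N : nat) (l : T -> 'I_N).
Hypotheses (mY : measurable Y) (ml : forall t, measurable [set x | l x = t]).

Definition cell t := Y `&` [set x | l x = t].

Lemma measurable_cell t : measurable (cell t).
Proof. exact: measurableI. Qed.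

Lemma cells_cover : \big[setU/set0]_(t : 'I_N) cell t = Y.
Proof.
apply/seteqP; split => [x|x Yx].
  by elim/big_rec: _ => // i s _ IH [[]//|/IH].
by rewrite (bigD1 (l x))//=; left.
Qed.

Lemma cells_trivIset (D : set 'I_N) : trivIset D cell.
Proof. by move=> s t _ _ [x [[_ <-] [_ <-]]]. Qed.

Lemma Rintegral_cells (f : T -> R) : mu.-integrable Y (EFin \o f) ->
  \int[mu]_(x in Y) f x = \sum_t \int[mu]_(x in cell t) f x.
Proof.
move=> If; rewrite /Rintegral -[in LHS]cells_cover integral_bigsetU_EFin//.
- rewrite -sum_fine// => t _; apply: integrable_fin_num;
  first exact: measurable_cell.
  by apply: integrableS If => //; [exact: measurable_cell|exact: subIsetl].
- exact: measurable_cell.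
- exact: index_enum_uniq.
- exact: cells_trivIset.
- by rewrite cells_cover; exact: measurable_int If.
Qed.

Lemma ge0_integral_cells (f : T -> \bar R) :
  measurable_fun Y f -> (forall x, Y x -> (0 <= f x)%E) ->
  (\int[mu]_(x in Y) f x = \sum_t \int[mu]_(x in cell t) f x)%E.
Proof.
move=> mf f0; rewrite -[in LHS]cells_cover ge0_integral_bigsetU//.
- exact: measurable_cell.
- exact: index_enum_uniq.
- exact: cells_trivIset.
- by rewrite cells_cover.
- by rewrite cells_cover.
Qed.

Lemma measure_cells (P : pred 'I_N) :
  (mu (Y `&` [set x | P (l x)]) = \sum_(t | P t) mu (cell t))%E.
Proof.
rewrite -measure_bigsetU_ord//; last 2 first.
- exact: measurable_cell.
- exact: cells_trivIset.
congr (mu _); apply/seteqP; split => [x [Yx Px]|x].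
  by rewrite (bigD1 (l x))//=; left.
elim/big_rec: _ => // i s Pi IH [[Yx /= li]|/IH//].
by split => //=; rewrite li.
Qed.

End cells.

Section normc_measurable.
Context {disp : measure_display} {T : measurableType disp} {R : realType}.
Implicit Types (D : set T) (F G : T -> R[i]).

Definition cmeasurable D F := measurable_fun D (fun x => complex.Re (F x)) /\
  measurable_fun D (fun x => complex.Im (F x)).

Lemma cmeasurable_normc D F : cmeasurable D F ->
  measurable_fun D (fun x => normc (F x)).
Proof.
move=> [mR mI].
have -> : (fun x => normc (F x)) =
    (@powR R ^~ 2^-1) \o (fun x =>
      complex.Re (F x) ^+ 2 + complex.Im (F x) ^+ 2).
  apply/funext => x /=; rewrite powR12_sqrt ?addr_ge0 ?sqr_ge0//.
  by case: (F x).
apply: measurableT_comp; first exact: measurable_powR.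
by apply: measurable_funD; exact: measurable_funX.
Qed.

Lemma cmeasurableM D F G : cmeasurable D F -> cmeasurable D G ->
  cmeasurable D (fun x => F x * G x).
Proof.
move=> [FR FI] [GR GI]; split.
  rewrite (_ : (fun x => complex.Re _) =
    (fun x => complex.Re (F x) * complex.Re (G x) -
    complex.Im (F x) * complex.Im (G x))); last first.
    by apply/funext => x; case: (F x) (G x) => ? ? [? ?].
  by apply: measurable_funB; exact: measurable_funM.
rewrite (_ : (fun x => complex.Im _) =
  (fun x => complex.Re (F x) * complex.Im (G x) +
    complex.Im (F x) * complex.Re (G x))); last first.
  by apply/funext => x; case: (F x) (G x) => ? ? [? ?].
by apply: measurable_funD; exact: measurable_funM.
Qed.

Lemma cmeasurableB D F G : cmeasurable D F -> cmeasurable D G ->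
  cmeasurable D (fun x => F x - G x).
Proof.
move=> [FR FI] [GR GI]; split.
  rewrite (_ : (fun x => complex.Re _) =
    (fun x => complex.Re (F x) - complex.Re (G x))).
    exact: measurable_funB.
  by apply/funext => x; case: (F x) (G x) => ? ? [? ?].
rewrite (_ : (fun x => complex.Im _) =
  (fun x => complex.Im (F x) - complex.Im (G x))).
  exact: measurable_funB.
by apply/funext => x; case: (F x) (G x) => ? ? [? ?].
Qed.

Lemma cmeasurableS D E F : measurable E -> D `<=` E -> cmeasurable E F ->
  cmeasurable D F.
Proof. by move=> mE DE [? ?]; split; apply: measurable_funS mE DE _. Qed.

Lemma cmeasurable_cst D z : cmeasurable D (fun=> z).
Proof. by split; exact: measurable_cst. Qed.

End normc_measurable.

Section complex_integrals.
Variables (R : realType) (d : nat) (mu : probability (borel_rV R d) R).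
Local Notation T := (borel_rV R d).
Variable f : T -> R[i].

(** Every integrand below is a bounded kernel times [f], so one bound by a multiple of |f| settles
    all questions of integrability. *)
Definition dominated (D : set T) (C : R) (F : T -> R[i]) :=
  cmeasurable D F /\ forall y, D y -> normc (F y) <= C * normc (f y).

Variable D : set T.
Hypotheses (mD : measurable D) (mf : cmeasurable D f).
Hypothesis If2 : mu.-integrable D (EFin \o (fun y => normc (f y) ^+ 2)).

Lemma integrable_normc : mu.-integrable D (EFin \o (fun y => normc (f y))).
Proof.
apply: (@le_integrable _ _ _ _ _ mD _
  (EFin \o (fun y => 1 + normc (f y) ^+ 2))).
- exact/measurable_EFinP/cmeasurable_normc.
- move=> y _ /=; rewrite lee_fin !ger0_norm ?normc_ge0//; last first.
    by rewrite addr_ge0// sqr_ge0.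
  have := sqr_ge0 (normc (f y) - 1); have := normc_ge0 (f y).
  by rewrite sqrrB1; lra.
- rewrite (_ : _ \o _ = (EFin \o cst 1) \+
  (EFin \o (fun y => normc (f y) ^+ 2))).
    by apply: integrableD => //; exact: finite_measure_integrable_cst.
  by apply/funext.
Qed.

Local Notation f1 := (\int[mu]_(y in D) normc (f y)).
Local Notation f2 := (\int[mu]_(y in D) normc (f y) ^+ 2).

Lemma Rint_normc_ge0 : 0 <= f1.
Proof. by apply: Rintegral_ge0 => y _; exact: normc_ge0. Qed.

(** The integral of (l - |f|)^2 is nonnegative for every real l, and the optimal l is the mean of
    |f|. *)
Lemma Rint_cauchy : f1 ^+ 2 <= fine (mu D) * f2.
Proof.
have H l : 2 * l * f1 <= l ^+ 2 * fine (mu D) + f2.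
  have I1 : mu.-integrable D (EFin \o (fun y => 2 * l * normc (f y))).
    exact: (integrableZl mD (2 * l) integrable_normc).
  have I0 : mu.-integrable D (EFin \o cst (l ^+ 2)).
    exact: finite_measure_integrable_cst.
  rewrite -RintegralZl//; last exact: integrable_normc.
  have <- : \int[mu]_(y in D) (l ^+ 2) =
    l ^+ 2 * fine (mu D) by rewrite Rintegral_cst.
  rewrite -RintegralD//; apply: le_Rintegral => //.
    rewrite (_ : _ \o _ = (EFin \o cst (l ^+ 2)) \+
      (EFin \o (fun y => normc (f y) ^+ 2))); last by apply/funext.
    exact: integrableD.
  move=> y _; have := sqr_ge0 (l - normc (f y)); rewrite sqrrB; lra.
have m0 : 0 <= fine (mu D) by apply: fine_ge0; exact: measure_ge0.
have [m00|mn0] := eqVneq (fine (mu D)) 0.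
  rewrite m00 mul0r; have [->|f1n0] := eqVneq f1 0; first by rewrite expr0n.
  have f10 : 0 < f1 by rewrite lt_def f1n0 Rint_normc_ge0.
  (* On a null set [H] bounds 2 l f1 by [f2] for all l; this l makes the left side [f2 + 1]. *)
  have := H ((f2 + 1) / (2 * f1)).
  rewrite m00 mulr0 add0r (_ : 2 * _ * _ = f2 + 1); first by lra.
  by field.
have mp : 0 < fine (mu D) by rewrite lt_def mn0.
have := H (f1 / fine (mu D)).
move: (fine (mu D)) (f1) (f2) mp => m a b mp h.
have : (2 * (a / m) * a) * m <=
  ((a / m) ^+ 2 * m + b) * m by rewrite ler_wpM2r// ltW.
rewrite (_ : 2 * (a / m) * a * m = 2 * a ^+ 2); last by field; rewrite gt_eqF.
rewrite (_ : ((a / m) ^+ 2 * m + b) * m = a ^+ 2 + m * b); last by field;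
  rewrite gt_eqF.
lra.
Qed.

Lemma dominated_Re C F : dominated D C F ->
  mu.-integrable D (EFin \o (fun y => complex.Re (F y))).
Proof.
move=> [[mR mI] h].
apply: (@le_integrable _ _ _ _ _ mD _ (EFin \o (fun y => C * normc (f y)))).
- exact/measurable_EFinP.
- move=> y Dy /=; rewrite lee_fin (le_trans (le_Re_normc _))//
  (le_trans (h y Dy))//.
  exact: ler_norm.
- exact: (integrableZl mD C integrable_normc).
Qed.

Lemma dominated_Im C F : dominated D C F ->
  mu.-integrable D (EFin \o (fun y => complex.Im (F y))).
Proof.
move=> [[mR mI] h].
apply: (@le_integrable _ _ _ _ _ mD _ (EFin \o (fun y => C * normc (f y)))).
- exact/measurable_EFinP.
- move=> y Dy /=; rewrite lee_fin (le_trans (le_Im_normc _))//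
  (le_trans (h y Dy))//.
  exact: ler_norm.
- exact: (integrableZl mD C integrable_normc).
Qed.

(* The factor 2 comes from treating real and imaginary parts separately. *)
Lemma cintegral_le C F : dominated D C F ->
  normc (cintegral mu D F) <= 2 * C * f1.
Proof.
move=> dF; have IR := dominated_Re dF; have II := dominated_Im dF;
  have [_ h] := dF.
rewrite (le_trans (normc_le_ReIm _))// /cintegral /=.
have key (g : T -> R) : mu.-integrable D (EFin \o g) ->
    (forall y, D y -> `|g y| <= C * normc (f y)) ->
    `|\int[mu]_(y in D) g y| <= C * f1.
  move=> Ig hg; rewrite (le_trans (le_normr_Rintegral mD Ig))//.
  rewrite -RintegralZl//; last exact: integrable_normc.
  apply: le_Rintegral => //; last exact: (integrableZl mD C integrable_normc).
  exact: (integrable_abse Ig).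
rewrite -mulrA mulr_natl mulr2n.
by apply: lerD; apply: key => // y Dy; apply: le_trans (h y Dy);
  [exact: le_Re_normc|exact: le_Im_normc].
Qed.

Lemma cintegralZ z C F : dominated D C F ->
  z * cintegral mu D F = cintegral mu D (fun y => z * F y).
Proof.
move=> dF; have IR := dominated_Re dF; have II := dominated_Im dF.
have IZ k (g : T -> R) : mu.-integrable D (EFin \o g) ->
   mu.-integrable D (EFin \o (fun y => k * g y)).
  by move=> Ig; exact: (integrableZl mD k Ig).
case: z => a b; rewrite /cintegral; apply/eqP; rewrite eq_complex /=;
  apply/andP; split; apply/eqP.
  rewrite -!RintegralZl// -RintegralB//; [|exact: IZ..].
  by apply: eq_Rintegral => y _; case: (F y).
rewrite -!RintegralZl// -RintegralD//; [|exact: IZ..].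
by apply: eq_Rintegral => y _; case: (F y).
Qed.

Lemma cintegralB C C' F G : dominated D C F -> dominated D C' G ->
  cintegral mu D F - cintegral mu D G = cintegral mu D (fun y => F y - G y).
Proof.
move=> dF dG; have IR := dominated_Re dF; have II := dominated_Im dF.
have JR := dominated_Re dG; have JI := dominated_Im dG.
rewrite /cintegral; apply/eqP; rewrite eq_complex /=; apply/andP; split;
  apply/eqP.
  by rewrite -RintegralB//; apply: eq_Rintegral => y _;
    case: (F y) (G y) => ? ? [].
by rewrite -RintegralB//; apply: eq_Rintegral => y _;
  case: (F y) (G y) => ? ? [].
Qed.

Lemma cintegral_cells C F N (l : T -> 'I_N) :
  (forall t, measurable [set x | l x = t]) -> dominated D C F ->
  cintegral mu D F = \sum_t cintegral mu (cell D l t) F.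
Proof.
move=> ml dF; have IR := dominated_Re dF; have II := dominated_Im dF.
apply/eqP; rewrite eq_complex; apply/andP; split; apply/eqP.
  rewrite (big_morph (@complex.Re R) (id1 := 0) (op1 := +%R)) //;
    last by move=> [? ?] [? ?].
  exact: Rintegral_cells.
rewrite (big_morph (@complex.Im R) (id1 := 0) (op1 := +%R)) //;
  last by move=> [? ?] [? ?].
exact: Rintegral_cells.
Qed.

End complex_integrals.

(** * Supports and doubling *)

Section topology_rV.
Variables (R : realType) (d : nat).
Local Notation T := (borel_rV R d).

Lemma closed_measurable_rV (A : set 'rV[R]_d) : closed A ->
  measurable (A : set T).
Proof.
move=> cA; rewrite -(setCK A); apply: measurableC; apply: open_measurable_rV.
exact: closed_openC.
Qed.

Lemma compact_closed_rV (A : set 'rV[R]_d) : compact A -> closed A.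
Proof. by apply: compact_closed; exact: norm_hausdorff. Qed.

Lemma measurable_cube (c : 'rV[R]_d) s : measurable (cube c s : set T).
Proof.
apply: closed_measurable_rV.
rewrite (_ : cube c s = \bigcap_(i in [set: 'I_d])
   ((fun x : 'rV[R]_d => x 0 i) @^-1` `[c 0 i - s / 2, c 0 i + s / 2]));
     last first.
  apply/seteqP; split => [x h i _|x h i].
    by rewrite /= in_itv /= -ler_distl; exact: h.
  by have := h i I; rewrite /= in_itv /= -ler_distl.
apply: closed_bigI => i _; apply: closed_comp; last exact: itv_closed.
by move=> x _; exact: coord_continuous.
Qed.

Lemma within_continuous_measurable (X : set 'rV[R]_d) (g : 'rV[R]_d -> R) :
  measurable (X : set T) -> {within X, continuous g} ->
  @measurable_fun _ _ T R X g.
Proof.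
move=> mX /continuousP cg; apply: (measurability _ (RGenOpens.measurableE R)).
move=> _ [_ [a [b ->] <-]].
have := cg _ (interval_open (a := BRight a) (b := BLeft b) isT isT).
move=> /open_subspaceP[V oV VE].
rewrite setIC -VE setIC; apply: measurableI => //; exact: open_measurable_rV.
Qed.

End topology_rV.

Section support.
Variables (R : realType) (d : nat) (mu : probability (borel_rV R d) R).
Local Notation T := (borel_rV R d).
Hypothesis cX : compact (supp mu).
Let X := supp mu.

Lemma measurable_supp : measurable (X : set T).
Proof. by apply: closed_measurable_rV; exact: compact_closed_rV. Qed.

Lemma off_supp_open_null x : ~ X x ->
  exists U : set 'rV[R]_d, [/\ open U, U x & mu U = 0%E].
Proof.
move=> Xx; apply: contrapT => H; apply: Xx => U oU Ux.
rewrite lt_def measure_ge0 andbT; apply/eqP => U0; apply: H; by exists U.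
Qed.

Lemma compact_off_supp_negligible (C : set 'rV[R]_d) :
  compact C -> C `&` X = set0 -> mu.-negligible (C : set T).
Proof.
move=> cC CX.
have : forall x, exists U : set 'rV[R]_d, [/\ open U, C x -> U x & mu U = 0%E].
  move=> x; have [Cx|Cx] := pselect (C x); last by exists set0; split => //;
    exact: open0.
  have /off_supp_open_null[U [oU Ux U0]] : ~ X x.
    by move=> Xx; suff : set0 x by []; rewrite -CX.
  by exists U.
move=> /choice[U UP].
move: cC; rewrite compact_cover => /(_ _ C U)[||D DC cov].
- by move=> x _; have [] := UP x.
- by move=> x Cx; exists x => //; have [_ h _] := UP x; exact: h.
apply: (@negligibleS _ T R mu _ _ cov); rewrite /cover bigcup_fset.
elim/big_ind: _ => [|A B nA nB|x _]; first exact: negligible_set0.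
  exact: negligibleU.
by apply/negligibleP; [apply: open_measurable_rV|]; have [] := UP x.
Qed.

(** Points off the support have null neighborhoods, but uncountably many of them. The complement is
    therefore exhausted by countably many compact sets, bounded and away from [X], each covered by
    finitely many such neighborhoods. *)
Lemma supp_full : mu (~` X : set T) = 0%E.
Proof.
have mX := measurable_supp.
apply/negligibleP; first exact: measurableC.
pose C n : set 'rV[R]_d := closed_ball_ Num.Def.normr 0 n.+1%:R `&`
   ~` (\bigcup_(y in X) ball y (n.+1%:R^-1)).
apply: (@negligibleS _ T R mu (\bigcup_n (C n))).
  move=> x /= Xx.
  have oX : open (~` X) by apply: closed_openC; exact: compact_closed_rV.
  have /nbhs_ballP[e /= e0 eX] : nbhs x (~` X) by exact: open_nbhs_nbhs.
  pose n := Num.truncn (Order.max `|x| e^-1).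
  have nlt : Order.max `|x| e^-1 < n.+1%:R by exact: truncnS_gt.
  move: nlt; rewrite gt_max => /andP[n1 n2].
  exists n => //; split; first by rewrite /closed_ball_ /= sub0r normrN ltW.
  move=> [y Xy]; rewrite -ball_normE /= => yx; apply: (eX y) => //.
  rewrite -ball_normE /= distrC (lt_trans yx)//.
  by rewrite invf_plt ?posrE.
apply: negligible_bigcup => n; apply: compact_off_supp_negligible.
  apply: bounded_closed_compact.
    exists n.+1%:R; split; first exact: num_real.
    move=> M nM x [] ; rewrite /closed_ball_ /= sub0r normrN => h _.
    exact: le_trans (ltW nM).
  apply: closedI; first by rewrite -closed_ballE//; exact: closed_ball_closed.
  apply: open_closedC; apply: bigcup_open => y _; exact: ball_open.
apply/seteqP; split => // x [[_ h] Xx]; apply: h; exists x => //.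
by apply: ballxx; rewrite invr_gt0.
Qed.

Lemma mu_suppI (A : set T) : measurable A -> mu (A `&` X) = mu A.
Proof.
move=> mA; have mX := measurable_supp.
have mXC := measurableC mX; have mAX := measurableI _ _ mA mX.
have mAXC := measurableI _ _ mA mXC.
have -> : mu A = mu ((A `&` X) `|` (A `&` ~` X)) by rewrite -setIUr setUv setIT.
rewrite measureU0//.
exact: (subset_measure0 mAXC mXC (@subIsetr _ _ _) supp_full).
Qed.

Lemma mu_supp : mu (X : set T) = 1%E.
Proof. by rewrite -[X]setTI mu_suppI// probability_setT. Qed.

Lemma supp_nonempty : X !=set0.
Proof.
apply/set0P/eqP => X0; have := mu_supp; rewrite X0 measure0 => -[/eqP].
by rewrite eq_sym oner_eq0.
Qed.

Lemma doubling_iter h CD c s i : 1 <= CD -> doubling mu h CD -> X c ->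
  h <= s -> 2 ^+ i * s <= 1 -> 0 <= s ->
  (mu (cube c (2 ^+ i * s)) <= (CD ^+ i)%:E * mu (cube c s))%E.
Proof.
move=> CD1 dbl Xc hs + s0; elim: i => [_|i IH is1];
  first by rewrite !expr0 mul1r mul1e.
have i1 : 2 ^+ i * s <= 1 / 2 by move: is1; rewrite exprS -mulrA; lra.
have i0 : h <= 2 ^+ i * s.
  by rewrite (le_trans hs)// ler_peMl// exprn_ege1// ler1n.
have := dbl c (2 ^+ i * s) Xc; rewrite i0 i1 => /(_ isT) h1.
rewrite exprS -mulrA (le_trans h1)// exprS EFinM -muleA lee_pmul2l ?IH//.
  by rewrite (le_trans i1)//; lra.
by rewrite lte_fin (lt_le_trans _ CD1).
Qed.

End support.

(** * Masses of the cells of a tree *)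

Section tree_weights.
Variables (R : realType) (d : nat) (mu : probability (borel_rV R d) R).
Local Notation T := (borel_rV R d).
Hypothesis cX : compact (supp mu).
Let X := supp mu.
Variables (r : nat -> R) (n : nat) (S : scale_tree X r n).
Let mX : measurable (X : set T) := measurable_supp cX.

Definition mass t : R := fine (mu (cell (X : set T) (leaf S) t)).

Lemma mass_ge0 t : 0 <= mass t.
Proof. by apply: fine_ge0; exact: measure_ge0. Qed.

Lemma mass_level k z : (level_sum mass k z)%:E =
  mu ((X : set T) `&` [set x | anc k (leaf S x) == z]).
Proof.
rewrite (measure_cells mu mX (@leaf_measurable _ _ _ _ _ S)
  (fun t => anc k t == z)).
rewrite /level_sum -sumEFin; apply: eq_bigr => t _;
  rewrite fineK// fin_num_measure//.
by apply: measurable_cell => //; exact: leaf_measurable.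
Qed.

Lemma mass_total : \sum_t mass t = 1.
Proof.
apply: EFin_inj; rewrite -(mu_supp cX) -/X.
have := measure_cells mu mX (@leaf_measurable _ _ _ _ _ S) predT.
rewrite (_ : _ `&` _ = X); last by apply/seteqP; split => [x []//|x Xx]; split.
move=> ->; rewrite -sumEFin; apply: eq_bigr => t _;
  rewrite fineK// fin_num_measure//.
by apply: measurable_cell => //; exact: leaf_measurable.
Qed.

(** With s = r(k+1) / 4, the child contains the part of X in the cube of side s about its center.
    The parent lies within 2 r(k) + r(k) of that center, hence in a cube of side 6 r(k) = 24 L s,
    and [q] doublings lead from one cube to the other. *)
Lemma mass_doubling h CD L q k t : (k < n)%N -> 1 <= CD -> doubling mu h CD ->
  0 < r k.+1 -> r k = L * r k.+1 -> 4 * h <= r k.+1 ->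
  24 * L <= 2 ^+ q -> 2 ^+ q * r k.+1 <= 4 ->
  (CD ^+ q)^-1 * level_sum mass k (anc k t) <= level_sum mass k.+1 (anc k.+1 t).
Proof.
move=> kn CD1 dbl r0 rL hr qL q4.
set a := anc k.+1 t; set z := anc k t; set s := r k.+1 / 4.
have Xa : X (center a) := center_in a.
have za : z = par k a by rewrite /z ancE.
have hs : h <= s by rewrite /s; lra.
have s0 : 0 <= s by rewrite /s; lra.
have s1 : 2 ^+ q * s <= 1 by rewrite /s mulrA; lra.
have dq := doubling_iter CD1 dbl Xa hs s1 s0.
have meas A : measurable (A : set T) -> measurable ((X : set T) `&` A).
  by move=> ?; exact: measurableI.
have ml (P : pred 'I_(leaves S).+1) : measurable
  ([set x | P (leaf S x)] : set T).
  rewrite (_ : [set x | _] =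
    \bigcup_(t in [set t | P t]) [set x | leaf S x = t]).
    by apply: fin_bigcup_measurable => // i _; exact: leaf_measurable.
  apply/seteqP; split => [x /= Px|x [i Pi /= xi]]; last by rewrite xi.
  by exists (leaf S x).
have mc e := measurable_cube (center a) e.
have up : (mu ((X : set T) `&` [set x | anc k (leaf S x) == z]) <=
  mu (cube (center a) (2 ^+ q * s)))%E.
  apply: le_measure; rewrite ?inE//;
    first exact: meas (ml (fun t => anc k t == z)).
  move=> x [Xx /= /eqP xz] i.
  have h1 := anc_dist S (ltnW kn) Xx; rewrite xz in h1.
  have h2 := par_dist a kn; rewrite -za in h2.
  have h3 := ler_distD (center z) x (center a);
    rewrite (distrC (center z)) in h3.
  have := coord_le_norm (x - center a) i; rewrite !mxE => /le_trans; apply.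
  rewrite (le_trans h3)//.
  have h4 : 24 * L * s <= 2 ^+ q * s by rewrite ler_wpM2r.
  have h5 : 24 * L * s = 6 * r k by rewrite rL /s; field.
  by move: h1 h2 h4; rewrite h5; lra.
have lo : (mu (cube (center a) s) <=
  mu ((X : set T) `&` [set x | anc k.+1 (leaf S x) == a]))%E.
  rewrite -(mu_suppI cX (mc s)); apply: le_measure; rewrite ?inE//.
  - exact: measurableI.
  - exact: meas (ml (fun t => anc k.+1 t == a)).
  move=> x [cx Xx]; split => //=; apply/eqP; apply: anc_ball => //.
  apply: (@le_lt_trans _ _ (s / 2)); last by rewrite /s -/a; lra.
  apply: rV_norm_le => [|i]; first by rewrite divr_ge0.
  by have := cx i; rewrite !mxE.
have CDq : 0 < CD ^+ q by rewrite exprn_gt0// (lt_le_trans _ CD1).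
rewrite mulrC ler_pdivrMr// mulrC -lee_fin EFinM !mass_level.
apply: (le_trans up); apply: (le_trans dq).
by rewrite lee_pmul2l.
Qed.

End tree_weights.

(** * The L^2 norm as a square integral *)

Section L2_norms.
Variables (R : realType) (d : nat) (mu : probability (borel_rV R d) R).
Local Notation T := (borel_rV R d).
Implicit Type f : 'rV[R]_d -> R[i].

Definition sqint f := (\int[mu]_(x in (supp mu : set T))
  (normc (f x) ^+ 2)%:E)%E.

Lemma sqint_ge0 f : (0 <= sqint f)%E.
Proof. by apply: integral_ge0 => x _; rewrite lee_fin sqr_ge0. Qed.

Lemma L2normE f : L2norm mu f = (sqint f `^ 2^-1)%E.
Proof.
rewrite /L2norm /sqint unlock /=; congr (_ `^ _)%E.
rewrite [RHS]integral_mkcond; apply: eq_integral => x _.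
rewrite /patch /=; case: ifP => _.
  rewrite -powR_mulrn ?normc_ge0// ger0_norm ?normc_ge0//.
by rewrite normr0 powR0.
Qed.

Lemma L2norm_le f B : 0 <= B -> (sqint f <= (B ^+ 2)%:E)%E ->
  (L2norm mu f <= B%:E)%E.
Proof.
move=> B0 h; rewrite L2normE.
have <- : ((B ^+ 2)%:E `^ 2^-1)%E = B%:E.
  by rewrite poweR_EFin powR12_sqrt ?sqr_ge0// sqrtr_sqr ger0_norm.
apply: gt0_ler_poweR => //.
  by rewrite in_itv /= sqint_ge0 leey.
by rewrite in_itv /= lee_fin sqr_ge0 leey.
Qed.

Lemma L2norm_lty f : (L2norm mu f < +oo)%E -> (sqint f < +oo)%E.
Proof. by rewrite L2normE; apply: lty_poweRy; rewrite invr_neq0. Qed.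

Lemma L2norm_le1 f : (L2norm mu f <= 1)%E -> (sqint f <= 1)%E.
Proof.
rewrite L2normE => h; rewrite -(poweRe1 (sqint_ge0 f))
  -[X in (_ `^ X)%E](@mulVf _ 2)//.
rewrite poweRrM.
have <- : ((1 : \bar R) `^ 2)%E = 1%E by rewrite poweR1r.
apply: gt0_ler_poweR => //; rewrite in_itv /=.
  by rewrite poweR_ge0 leey.
by rewrite lee01 leey.
Qed.

End L2_norms.

(** * The oscillatory operator *)

Section operator_bounds.
Variables (R : realType) (d : nat) (a b : 'rV[R]_d).
Variables (Phi : 'rV[R]_d -> 'rV[R]_d -> R) (p : 'rV[R]_d -> 'rV[R]_d -> R[i]).
Variables (M M1 P P' h : R).
Local Notation T := (borel_rV R d).
Local Notation boxX := (unit_box a).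
Local Notation boxY := (unit_box b).
Hypothesis cPhi : forall x, boxX x -> {within boxY, continuous (Phi x)}.
Hypothesis cRe : forall x, boxX x ->
  {within boxY, continuous (fun y => complex.Re (p x y))}.
Hypothesis cIm : forall x, boxX x ->
  {within boxY, continuous (fun y => complex.Im (p x y))}.
Hypotheses (M0 : 0 <= M) (M10 : 0 <= M1) (P0 : 0 <= P) (P'0 : 0 <= P')
  (h0 : 0 < h).
Hypothesis mixed_le : forall x x' y y', boxX x -> boxX x' -> boxY y ->
  boxY y' ->
  `|mixed_diff Phi x x' y y'| <= M * `|x - x'| * `|y - y'|.
Hypothesis lipPhi : forall x x' y, boxX x -> boxX x' -> boxY y ->
  `|Phi x y - Phi x' y| <= M1 * `|x - x'|.
Hypothesis pP : forall x y, boxX x -> boxY y -> normc (p x y) <= P.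
Hypothesis pP' : forall x x' y, boxX x -> boxX x' -> boxY y ->
  normc (p x y - p x' y) <= P' * `|x - x'|.

Definition kern x y := cis (Phi x y / h) * p x y.

Lemma normc_kern x y : boxX x -> boxY y -> normc (kern x y) <= P.
Proof. by move=> ax yb; rewrite /kern normcM normc_cis mul1r pP. Qed.

(** After the twist the phases at x and x' differ by a mixed difference over [h]. This gains the
    factor [rho] over the untwisted kernel, whose Lipschitz constant is of order 1/h. *)
Lemma kern_twist x x' y w rho : boxX x -> boxX x' -> boxY y -> boxY w ->
  `|y - w| <= rho ->
  normc (cis (- (Phi x w / h)) * kern x y - cis (- (Phi x' w / h)) * kern x' y)
    <=
  (M * rho / h * P + P') * `|x - x'|.
Proof.
move=> ax ax' yb wb yw; rewrite /kern !mulrA -!cisD.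
set s := - (Phi x w / h) + _; set s' := - (Phi x' w / h) + _.
have -> : cis s * p x y - cis s' * p x' y =
  (cis s - cis s') * p x y + cis s' * (p x y - p x' y).
  by rewrite mulrBl mulrBr addrA subrK.
rewrite (le_trans (le_normc_add _ _))// [leRHS]mulrDl lerD//; last first.
  by rewrite normcM normc_cis mul1r pP'.
rewrite normcM [leRHS](_ : _ = (M * `|x - x'| * rho / h) * P); last by ring.
apply: ler_pM; rewrite ?normc_ge0 ?pP//.
rewrite (le_trans (normc_cisB_le _ _))//.
have -> : s - s' = mixed_diff Phi x x' y w / h by rewrite /s /s' /mixed_diff;
  ring.
rewrite normrM (gtr0_norm (_ : 0 < h^-1)) ?invr_gt0//
  ler_wpM2r ?invr_ge0 ?(ltW h0)//.
by rewrite (le_trans (mixed_le ax ax' yb wb))// ler_wpM2l ?mulr_ge0.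
Qed.

(** A constant of order 1/h is harmless here: it only has to make the image of f continuous on X,
    hence measurable. *)
Lemma kern_lip x x' y : boxX x -> boxX x' -> boxY y ->
  normc (kern x y - kern x' y) <= (M1 / h * P + P') * `|x - x'|.
Proof.
move=> ax ax' yb; rewrite /kern; set s := Phi x y / h; set s' := Phi x' y / h.
have -> : cis s * p x y - cis s' * p x' y =
  (cis s - cis s') * p x y + cis s' * (p x y - p x' y).
  by rewrite mulrBl mulrBr addrA subrK.
rewrite (le_trans (le_normc_add _ _))// [leRHS]mulrDl lerD//; last first.
  by rewrite normcM normc_cis mul1r pP'.
rewrite normcM [leRHS](_ : _ = (M1 * `|x - x'| / h) * P); last by ring.
apply: ler_pM; rewrite ?normc_ge0 ?pP//.
rewrite (le_trans (normc_cisB_le _ _))// /s /s' -mulrBl normrM.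
by rewrite (gtr0_norm (_ : 0 < h^-1)) ?invr_gt0//
  ler_wpM2r ?invr_ge0 ?(ltW h0)// lipPhi.
Qed.

Variable muY : probability T R.
Let Y := supp muY.
Hypotheses (cY : compact Y) (sY : Y `<=` boxY).
Let mY : measurable (Y : set T) := measurable_supp cY.
Variable f : 'rV[R]_d -> R[i].
Hypothesis fL2 : inL2 muY f.

Lemma inL2_cmeasurable : cmeasurable (Y : set T) f.
Proof. by have [mR mI _] := fL2. Qed.

Lemma inL2_integrable : muY.-integrable (Y : set T)
  (EFin \o (fun y => normc (f y) ^+ 2)).
Proof.
have [_ _ /L2norm_lty fin] := fL2.
apply/integrableP; split.
  by apply/measurable_EFinP; apply: measurable_funX;
    exact: cmeasurable_normc inL2_cmeasurable.
under eq_integral do rewrite /= ger0_norm ?sqr_ge0//.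
exact: fin.
Qed.

Lemma sub_cmeasurable (D : set T) : D `<=` Y -> cmeasurable D f.
Proof. by move=> DY; exact: cmeasurableS mY DY inL2_cmeasurable. Qed.

Lemma sub_integrable (D : set T) : measurable D -> D `<=` Y ->
  muY.-integrable D (EFin \o (fun y => normc (f y) ^+ 2)).
Proof. by move=> mD DY; exact: integrableS mY mD DY inL2_integrable. Qed.

Lemma box_measurable (g : 'rV[R]_d -> R) (D : set T) : D `<=` Y ->
  {within boxY, continuous g} -> @measurable_fun _ _ T R D g.
Proof.
move=> DY cg; have mb : measurable (boxY : set T).
  by apply: closed_measurable_rV; exact: unit_box_closed.
apply: (@measurable_funS _ _ T R boxY) => //; first exact: subset_trans DY sY.
exact: within_continuous_measurable.
Qed.

Lemma cmeasurable_kern (D : set T) x : D `<=` Y -> boxX x ->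
  @cmeasurable _ T R D (kern x).
Proof.
move=> DY ax; apply: cmeasurableM; last first.
  by split; apply: box_measurable => //; [exact: cRe|exact: cIm].
have mPhi : @measurable_fun _ _ T R D (fun y => Phi x y / h).
  have m1 : @measurable_fun _ _ T R D (Phi x) by apply: box_measurable => //;
    exact: cPhi.
  exact: (measurable_funM m1 (measurable_cst _)).
split.
  by apply: (measurableT_comp _ mPhi); apply: continuous_measurable_fun;
    exact: continuous_cos.
by apply: (measurableT_comp _ mPhi); apply: continuous_measurable_fun;
  exact: continuous_sin.
Qed.

Lemma dominated_scaled (D : set T) (k : 'rV[R]_d -> R[i]) C : D `<=` Y ->
  @cmeasurable _ T R D k -> (forall y, D y -> normc (k y) <= C) ->
  dominated f D C (fun y => k y * f y).
Proof.
move=> DY mk kC; split; first by apply: cmeasurableM mk (sub_cmeasurable DY).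
by move=> y Dy; rewrite normcM ler_wpM2r ?normc_ge0 ?kC.
Qed.

Lemma dominated_kern (D : set T) x : D `<=` Y -> boxX x ->
  dominated f D P (fun y => kern x y * f y).
Proof.
move=> DY ax; apply: dominated_scaled => //; first exact: cmeasurable_kern.
by move=> y Dy; apply: normc_kern => //; exact/sY/DY.
Qed.

Lemma oscillatory_opE x :
  oscillatory_op Phi p h muY f x = cintegral muY Y (fun y => kern x y * f y).
Proof. by []. Qed.

Lemma cell_twist (D : set T) x x' w rho : measurable D -> D `<=` Y ->
  boxX x -> boxX x' -> boxY w -> (forall y, D y -> `|y - w| <= rho) ->
  normc (cis (- (Phi x w / h)) * cintegral muY D (fun y => kern x y * f y) -
         cis (- (Phi x' w / h)) * cintegral muY D (fun y => kern x' y * f y)) <=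
  2 * (M * rho / h * P + P') * `|x - x'| * \int[muY]_(y in D) normc (f y).
Proof.
move=> mD DY ax ax' wb Dw.
have mf := sub_cmeasurable DY; have If := sub_integrable mD DY.
have dk v : boxX v -> dominated f D P
  (fun y => (cis (- (Phi v w / h)) * kern v y) * f y).
  move=> av; apply: dominated_scaled => //.
    by apply: cmeasurableM; [exact: cmeasurable_cst|exact: cmeasurable_kern].
  move=> y Dy; rewrite normcM normc_cis mul1r; apply: normc_kern => //;
    exact/sY/DY.
have cz v : boxX v -> cis (- (Phi v w / h)) *
  cintegral muY D (fun y => kern v y * f y) =
    cintegral muY D (fun y => (cis (- (Phi v w / h)) * kern v y) * f y).
  move=> av; rewrite (cintegralZ mD mf If _ (dominated_kern DY av)).
  by congr cintegral; apply/funext => y; rewrite mulrA.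
rewrite !cz// (cintegralB mD mf If (dk _ ax) (dk _ ax')).
rewrite -(mulrA 2); apply: (cintegral_le mD mf If); split.
  by apply: cmeasurableB; [have [] := dk _ ax|have [] := dk _ ax'].
move=> y Dy; rewrite -mulrBl normcM ler_wpM2r ?normc_ge0//.
by apply: kern_twist => //; [exact/sY/DY|exact: Dw].
Qed.

Lemma op_lip x x' : boxX x -> boxX x' ->
  normc (oscillatory_op Phi p h muY f x - oscillatory_op Phi p h muY f x') <=
  2 * ((M1 / h * P + P') * `|x - x'|) * \int[muY]_(y in Y) normc (f y).
Proof.
move=> ax ax'; have DY : (Y : set T) `<=` Y by [].
have mf := sub_cmeasurable DY; have If := sub_integrable mY DY.
rewrite !oscillatory_opE (cintegralB mY mf If (dominated_kern DY ax)
  (dominated_kern DY ax')).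
apply: (cintegral_le mY mf If); split.
  by apply: cmeasurableB; [have [] := dominated_kern DY ax|have [] :=
    dominated_kern DY ax'].
move=> y Dy; rewrite -mulrBl normcM ler_wpM2r ?normc_ge0//.
by apply: kern_lip => //; exact/sY.
Qed.

Lemma op_bound x : boxX x ->
  normc (oscillatory_op Phi p h muY f x) <=
    2 * P * \int[muY]_(y in Y) normc (f y).
Proof.
move=> ax; have DY : (Y : set T) `<=` Y by [].
have mf := sub_cmeasurable DY; have If := sub_integrable mY DY.
by rewrite oscillatory_opE; apply: (cintegral_le mY mf If);
  exact: dominated_kern.
Qed.

Variable muX : probability T R.
Let X := supp muX.
Hypotheses (cX : compact X) (sX : X `<=` boxX).
Let mX : measurable (X : set T) := measurable_supp cX.

Lemma op_cmeasurable : cmeasurable (X : set T) (oscillatory_op Phi p h muY f).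
Proof.
set I := \int[muY]_(y in Y) normc (f y).
have I0 : 0 <= I by apply: Rintegral_ge0 => y _; exact: normc_ge0.
pose C := 2 * (M1 / h * P + P') * I.
have C0 : 0 <= C.
  by rewrite !mulr_ge0// addr_ge0// mulr_ge0// divr_ge0// ltW.
have lip (g : R[i] -> R) : (forall z z', `|g z - g z'| <= normc (z - z')) ->
    {within X, continuous (fun x => g (oscillatory_op Phi p h muY f x))}.
  move=> gl; apply/within_continuousP => x Xx e e0.
  exists (e / (C + 1)); first by rewrite divr_gt0// ltr_wpDl.
  move=> x' Xx'; rewrite ltr_pdivlMr ?ltr_wpDl// => xx'.
  apply: le_lt_trans xx'; rewrite (le_trans (gl _ _))//
    (le_trans (op_lip (sX Xx) (sX Xx')))//.
  rewrite -/I [leLHS](_ : _ = `|x - x'| * C); last by rewrite /C; ring.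
  by rewrite ler_wpM2l// lerDl.
split; apply: within_continuous_measurable => //; apply: lip => z z'.
  by rewrite (_ : complex.Re z - _ = complex.Re (z - z')) ?le_Re_normc//;
    case: z z' => ? ? [].
by rewrite (_ : complex.Im z - _ = complex.Im (z - z')) ?le_Im_normc//;
  case: z z' => ? ? [].
Qed.

Let f2 := \int[muY]_(y in Y) normc (f y) ^+ 2.

Lemma f2E : (f2%:E = sqint muY f)%E.
Proof. by rewrite /f2 /Rintegral fineK//; apply: integrable_fin_num => //;
  exact: inL2_integrable. Qed.

(** The bound without decay. It serves when [h] is bounded below, and to see that the operator maps
    into L^2. *)
Lemma op_sqint_trivial :
  (sqint muX (oscillatory_op Phi p h muY f) <= ((2 * P) ^+ 2 * f2)%:E)%E.
Proof.
have DY : (Y : set T) `<=` Y by [].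
have c := Rint_cauchy mY (sub_cmeasurable DY) (sub_integrable mY DY).
rewrite (mu_supp cY) /= mul1r in c.
rewrite -[leRHS]mule1 -(mu_supp cX) -(integral_cst muX mX).
apply: ge0_le_integral => //.
- by move=> x _; rewrite lee_fin sqr_ge0.
- apply/measurable_EFinP; apply: measurable_funX.
  exact: cmeasurable_normc op_cmeasurable.
- move=> x Xx /=; rewrite lee_fin; have := op_bound (sX Xx);
  set I := Rintegral _ _ _ => h1.
  apply: (@le_trans _ _ ((2 * P * I) ^+ 2)).
    rewrite ler_sqr ?nnegrE ?normc_ge0 ?mulr_ge0//.
    by apply: Rintegral_ge0 => y _; exact: normc_ge0.
  by rewrite exprMn ler_wpM2l// sqr_ge0.
Qed.

Lemma op_inL2 : inL2 muX (oscillatory_op Phi p h muY f).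
Proof.
have [mR mI] := op_cmeasurable; split => //.
have f20 : 0 <= f2 by apply: Rintegral_ge0 => y _; exact: sqr_ge0.
apply: le_lt_trans (L2norm_le (B := Num.sqrt ((2 * P) ^+ 2 * f2)) _ _) (ltry _).
  exact: sqrtr_ge0.
by rewrite sqr_sqrtr ?mulr_ge0 ?sqr_ge0// op_sqint_trivial.
Qed.

Section trees.
Variables (n : nat) (rX rY : nat -> R) (kap c g L : R).
Variables (TX : scale_tree X rX n) (TY : scale_tree Y rY n).
Hypotheses (n0 : (0 < n)%N).
Hypotheses (Mge1 : 1 <= M) (c01 : 0 < c <= 1) (g01 : 0 < g <= 1).
Hypothesis nonorth : nonorthogonal Phi X Y c h h 1 1.
Hypothesis gX : forall k t, (k < n)%N ->
  g * level_sum (@mass R d muX rX n TX) k (anc k t) <=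
    level_sum (@mass R d muX rX n TX) k.+1 (anc k.+1 t).
Hypothesis gY : forall k t, (k < n)%N ->
  g * level_sum (@mass R d muY rY n TY) k (anc k t) <=
    level_sum (@mass R d muY rY n TY) k.+1 (anc k.+1 t).
Hypotheses (rX0 : forall k, 0 < rX k) (rY0 : forall k, 0 < rY k).
Hypotheses (rXL : forall k, rX k.+1 = rX k / L)
  (rYL : forall k, rY k.+1 = rY k / L).
Hypotheses (kap0 : 0 < kap) (kapM : M * kap <= 1).
Let tau0 := c * kap / 32.
Let theta := 64 / tau0.
Let eta := g ^+ 2 * (tau0 / 64) ^+ 2.
Hypotheses (L16 : 16 <= L) (LM : 512 * M <= c * L)
  (Ltheta : 2 * (theta * M * kap + 1) <= L).
Hypothesis rr : forall k, (k < n)%N -> rX k * rY (n.-1 - k)%N = kap * h.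
Hypothesis hX : forall k, (k < n)%N -> 4 * h < rX k < 4.
Hypothesis hY : forall k, (k < n)%N -> 4 * h < rY k < 4.
Hypothesis rX1 : rX 0%N <= 1.

Let lY : forall t, measurable ([set y | leaf TY y = t] : set T) :=
  @leaf_measurable _ _ _ _ _ TY.
Let lX : forall t, measurable ([set y | leaf TX y = t] : set T) :=
  @leaf_measurable _ _ _ _ _ TX.
Let cellY t := cell (Y : set T) (leaf TY) t.

Let u t x := cintegral muY (cellY t) (fun y => kern x y * f y).
Let F1 t := \int[muY]_(y in cellY t) normc (f y).
Let F2 t := \int[muY]_(y in cellY t) normc (f y) ^+ 2.

Lemma op_sqint_trees :
  (sqint muX (oscillatory_op Phi p h muY f) <=
   ((1 - eta) ^+ n * (((2 * P) + theta * (4 * P + 2 * P')) ^+ 2 * f2))%:E)%E.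
Proof.
have mc t : measurable (cellY t) by exact: measurable_cell.
have sc t : cellY t `<=` Y by exact: subIsetl.
have mfc t := sub_cmeasurable (sc t).
have Ifc t := sub_integrable (mc t) (sc t).
have F10 t : 0 <= F1 t by apply: Rintegral_ge0 => y _; exact: normc_ge0.
have F20 t : 0 <= F2 t by apply: Rintegral_ge0 => y _; exact: sqr_ge0.
have F12 t : F1 t ^+ 2 <= @mass R d muY rY n TY t * F2 t by exact: Rint_cauchy.
have L0 : 0 < L by exact: lt_le_trans L16.
have c0 : 0 < c by case/andP: c01.
have tau00 : 0 < tau0 by rewrite divr_gt0// mulr_gt0.
have theta0 : 0 < theta by rewrite divr_gt0.
(* The inner 2 is the radius of a cell in [anc_dist], the outer one the loss in [cintegral_le]. *)
pose K := 2 * (M * (2 * rY n) / h * P + P').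
have rYn := rY0 n.
have K0 : 0 <= K.
  by rewrite mulr_ge0// addr_ge0// mulr_ge0// divr_ge0 ?(ltW h0)//
    !mulr_ge0 ?(ltW rYn).
have uP t x : X x -> normc (u t x) <= 2 * P * F1 t.
  by move=> Xx; apply: (cintegral_le (mc t) (mfc t) (Ifc t));
    apply: dominated_kern => //; exact: sX.
have uK t w x x' : X x -> X x' -> anc n t = w ->
  normc (cis (- (Phi x (center w) / h)) * u t x -
         cis (- (Phi x' (center w) / h)) * u t x') <= K * `|x - x'| * F1 t.
  move=> Xx Xx' tw; apply: cell_twist => //;
    [exact: sX|exact: sX|exact: (sY (center_in w))|].
  move=> y [Yy /= yt]; have := anc_dist TY (leqnn n) Yy.
  by rewrite yt tw.
have ml x x' y y' : X x -> X x' -> Y y -> Y y' ->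
    `|mixed_diff Phi x x' y y'| <= M * `|x - x'| * `|y - y'|.
  by move=> Xx Xx' Yy Yy'; apply: mixed_le;
    [exact: sX|exact: sX|exact: sY|exact: sY].
have P20 : 0 <= 2 * P by rewrite mulr_ge0.
have [phi [phi0 hphi sphi]] :=
  finite_bound (@mass_ge0 _ _ muX _ _ TX) (@mass_ge0 _ _ muY _ _ TY) h0 Mge1
    c01 g01
  ml nonorth gX gY rX0 rY0 rXL rYL kap0 kapM L16 LM Ltheta rr hX hY
  (@mass_total _ _ muX cX _ _ TX) (@mass_total _ _ muY cY _ _ TY) F10 F20 F12
    P20 K0 uP uK.
have uB x : X x -> \sum_t u t x = oscillatory_op Phi p h muY f x.
  move=> Xx; have DY : (Y : set T) `<=` Y by [].
  rewrite oscillatory_opE.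
  by rewrite (cintegral_cells mY (sub_cmeasurable DY) (sub_integrable mY DY) lY
    (dominated_kern DY (sX Xx))).
have F2s : \sum_t F2 t = f2.
  by rewrite /f2 (Rintegral_cells mY lY inL2_integrable).
have Bm : @measurable_fun _ _ T _ X
  (fun x => (normc (oscillatory_op Phi p h muY f x) ^+ 2)%:E).
  apply/measurable_EFinP; apply: measurable_funX;
    exact: cmeasurable_normc op_cmeasurable.
apply: (@le_trans _ _ (\sum_t @mass R d muX rX n TX t * phi t)%:E).
  rewrite /sqint (ge0_integral_cells muX mX lX Bm); last by move=> x _;
    rewrite lee_fin sqr_ge0.
  rewrite -sumEFin; apply: lee_sum => t _.
  have mct : measurable (cell (X : set T) (leaf TX) t) by exact:
    measurable_cell.
  rewrite mulrC EFinM /mass fineK ?fin_num_measure// -(integral_cst muX mct).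
  apply: ge0_le_integral => //.
  - by move=> x _; rewrite lee_fin sqr_ge0.
  - by apply: measurable_funS Bm => //; exact: subIsetl.
  - move=> x [Xx xt]; have {xt} <- : leaf TX x = t := xt.
    by rewrite lee_fin -(uB x Xx); exact: hphi.
rewrite lee_fin (le_trans sphi)// F2s -/tau0 -/theta -/eta.
have eta1 : 0 <= 1 - eta.
  have /andP[h1 _] := q_bounds Mge1 c01 g01 kap0 kapM.
  case/andP: g01 => g0 g1.
  rewrite subr_ge0 /eta expr2 -mulrA; apply: mulr_ile1 => //; first exact: ltW.
    by rewrite mulr_ge0 ?sqr_ge0// ltW.
  by move: h1; rewrite -/tau0; lra.
rewrite ler_wpM2l ?exprn_ge0// ler_wpM2r//.
  by apply: Rintegral_ge0 => y _; exact: sqr_ge0.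
have rXY : rX 0 * rY n = kap * h / L.
  have := rr n0; rewrite subn0 => <-.
  by rewrite -{1}(prednK n0) rYL mulrA.
(* [K] contains 1/h, but the initial pair of levels (0, n) has a product of radii of only kap h / L,
   so the starting constant does not depend on [h]. *)
have rXK : rX 0 * K <= 4 * P + 2 * P'.
  have -> : rX 0 * K = 4 * (M * kap / L) * P + 2 * P' * rX 0.
    rewrite /K; transitivity (4 * M * (rX 0 * rY n) / h * P + 2 * P' * rX 0);
      first by ring.
    by rewrite rXY; field; rewrite !gt_eqF.
  apply: lerD.
    rewrite ler_wpM2r// ler_piMr// ler_pdivrMr// mul1r (le_trans kapM)//
      (le_trans _ L16)//.
    by rewrite ler1n.
  by rewrite ler_piMr// mulr_ge0.
have rX00 := rX0 0%N.
have lo : 0 <= 2 * P + theta * rX 0 * K.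
  by rewrite addr_ge0// mulr_ge0// mulr_ge0 ?(ltW theta0) ?(ltW rX00).
have le1 : 2 * P + theta * rX 0 * K <= 2 * P + theta * (4 * P + 2 * P').
  by rewrite lerD2l -mulrA ler_wpM2l ?(ltW theta0).
by rewrite ler_sqr ?nnegrE// (le_trans lo).
Qed.

End trees.
End operator_bounds.

(** * Choice of the scales *)

Section rates.
Variable R : realType.

Lemma expn_unbounded (L x : R) : 2 <= L -> exists m, x < L ^+ m.
Proof.
move=> L2; pose m := Num.truncn x; exists m.+1.
apply: lt_le_trans (truncnS_gt x) _; rewrite -/m.
apply: (@le_trans _ _ (2 ^+ m.+1)).
  by rewrite -natrX ler_nat ltnW// ltn_expl.
by rewrite lerXn2r ?nnegrE// (le_trans _ L2).
Qed.

Lemma expn_bracket (L x : R) : 2 <= L -> 1 <= x ->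
  exists m, L ^+ m <= x < L ^+ m.+1.
Proof.
move=> L2 x1; have := expn_unbounded x L2.
move=> ex; case: (ex_minnP ex) => -[|m] xm mini.
  by move: xm; rewrite expr0 ltNge x1.
exists m; rewrite xm andbT leNgt; apply/negP => /mini; by rewrite ltnn.
Qed.

(** The exponent solves L^(-s) = 1 - eta, so (1 - eta)^n is the power -s of L^n, which exceeds
    1/x. *)
Lemma decay_rate (eta L : R) : 0 < eta < 1 -> 1 < L ->
  exists2 s, 0 < s & forall n x, 0 < x -> x^-1 < L ^+ n ->
    (1 - eta) ^+ n <= x `^ s.
Proof.
move=> /andP[e0 e1] L1.
have lnL : 0 < ln L by rewrite ln_gt0.
have y0 : 0 < 1 - eta by rewrite subr_gt0.
have lny : ln (1 - eta) < 0 by rewrite ln_lt0// y0/= ltrBlDr ltrDl.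
exists (- ln (1 - eta) / ln L); first by rewrite divr_gt0// oppr_gt0.
move=> n x x0 xL.
have L0 : 0 < L by rewrite (lt_trans _ L1).
rewrite -powR_mulrn ?(ltW y0)// /powR !gt_eqF// ler_expR.
have : ln (x^-1) < ln (L ^+ n) by rewrite ltr_ln// posrE ?invr_gt0 ?exprn_gt0.
rewrite lnV ?posrE// lnXn// => h.
have -> : - ln (1 - eta) / ln L * ln x =
  (ln (1 - eta) / ln L) * (- ln x) by ring.
have -> : n%:R * ln (1 - eta) = (ln (1 - eta) / ln L) * (n%:R * ln L).
  by field; rewrite gt_eqF.
apply: ler_wnM2l; first by rewrite ltW// pmulr_llt0// invr_gt0.
by move: h; rewrite mulr_natl => /ltW.
Qed.

End rates.

Lemma doublingW (R : realType) (d : nat) (mu : probability (borel_rV R d) R) h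
  C C' :
  C <= C' -> doubling mu h C -> doubling mu h C'.
Proof.
move=> CC dbl c r Xc hr; apply: le_trans (dbl c r Xc hr) _.
by apply: lee_wpmul2r; rewrite ?measure_ge0// lee_fin.
Qed.

Section conclusion.
Variables (R : realType) (d : nat) (a b : 'rV[R]_d).
Variables (Phi : 'rV[R]_d -> 'rV[R]_d -> R) (p : 'rV[R]_d -> 'rV[R]_d -> R[i]).
Variables (M M1 P P' CD cN : R).
Local Notation T := (borel_rV R d).
Local Notation boxX := (unit_box a).
Local Notation boxY := (unit_box b).
Hypothesis cPhi : forall x, boxX x -> {within boxY, continuous (Phi x)}.
Hypothesis cRe : forall x, boxX x ->
  {within boxY, continuous (fun y => complex.Re (p x y))}.
Hypothesis cIm : forall x, boxX x ->
  {within boxY, continuous (fun y => complex.Im (p x y))}.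
Hypotheses (M11 : 1 <= M) (M10 : 0 <= M1) (P0 : 0 <= P) (P'0 : 0 <= P').
Hypothesis mixed_le : forall x x' y y', boxX x -> boxX x' -> boxY y ->
  boxY y' ->
  `|mixed_diff Phi x x' y y'| <= M * `|x - x'| * `|y - y'|.
Hypothesis lipPhi : forall x x' y, boxX x -> boxX x' -> boxY y ->
  `|Phi x y - Phi x' y| <= M1 * `|x - x'|.
Hypothesis pP : forall x y, boxX x -> boxY y -> normc (p x y) <= P.
Hypothesis pP' : forall x x' y, boxX x -> boxX x' -> boxY y ->
  normc (p x y - p x' y) <= P' * `|x - x'|.
Hypotheses (CD1 : 1 <= CD) (cN01 : 0 < cN <= 1).

Lemma sqint_decay : exists s D : R, [/\ 0 < s, 0 < D &
  forall h : R, 0 < h < 1 -> forall muX muY : probability T R,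
    compact (supp muX) -> compact (supp muY) ->
    supp muX `<=` boxX -> supp muY `<=` boxY ->
    doubling muX h CD -> doubling muY h CD ->
    nonorthogonal Phi (supp muX) (supp muY) cN h h 1 1 ->
    forall f, inL2 muY f -> (L2norm muY f <= 1)%E ->
    (sqint muX (oscillatory_op Phi p h muY f) <= (D * h `^ s)%:E)%E].
Proof.
have M0 : 0 < M by exact: lt_le_trans M11.
case/andP: (cN01) => c0 c1.
pose kap := M^-1; pose tau0 := cN * kap / 32; pose theta := 64 / tau0.
have kap0 : 0 < kap by rewrite invr_gt0.
have kapM : M * kap = 1 by rewrite mulfV// gt_eqF.
have kap1 : kap <= 1 by rewrite invf_le1.
have tau00 : 0 < tau0 by rewrite divr_gt0// mulr_gt0.
have theta0 : 0 < theta by rewrite divr_gt0.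
(* One summand for each of [L16], [LM] and [Ltheta]; in the last one [M * kap] is 1. *)
pose L := 16 + 512 * M / cN + 2 * (theta + 1).
have Mc0 : 0 < 512 * M / cN by rewrite divr_gt0// mulr_gt0.
have L16 : 16 <= L by rewrite /L; lra.
have L0 : 0 < L by lra.
have LM : 512 * M <= cN * L.
  rewrite [leRHS]mulrC -ler_pdivrMr// /L; lra.
have Ltheta : 2 * (theta * M * kap + 1) <= L by rewrite -mulrA kapM mulr1 /L;
  lra.
have [q /ltW qL] : exists q, 24 * L < 2 ^+ q :> R by exact: expn_unbounded.
have q0 : 0 < 2 ^+ q :> R by rewrite exprn_gt0.
have q1 : 1 <= 2 ^+ q :> R by rewrite exprn_ege1// ler1n.
pose g := (CD ^+ q)^-1.
have CDq : 1 <= CD ^+ q by rewrite exprn_ege1.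
have g01 : 0 < g <= 1 by rewrite invr_gt0 (lt_le_trans _ CDq)//=
  invf_le1// (lt_le_trans _ CDq).
(* The coarsest radius in Y. It is small enough for the finest radii to remain above 4h ([rho0_kap])
   and for the cubes of the doubling argument to have side at most 1 ([rho0_q]). *)
pose rho0 := kap / (4 * L * 2 ^+ q).
have rho00 : 0 < rho0 by rewrite divr_gt0// !mulr_gt0.
have rho0_kap : rho0 * (4 * L) <= kap.
  rewrite /rho0 (_ : _ * _ = kap / 2 ^+ q); last by field; rewrite !gt_eqF.
  by rewrite ler_pdivrMr// ler_peMr// ltW.
have rho0_q : 2 ^+ q * rho0 <= 1.
  rewrite /rho0 (_ : _ * _ = kap / (4 * L)); last by field; rewrite !gt_eqF.
  by rewrite ler_pdivrMr ?mulr_gt0//; lra.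
have rho01 : rho0 <= 1 by apply: le_trans rho0_q; rewrite ler_peMl// ltW.
pose eta := g ^+ 2 * (tau0 / 64) ^+ 2.
have eta01 : 0 < eta < 1.
  have /andP[h1 h2] := q_bounds M11 cN01 g01 kap0
    (eq_ind_r (fun z => z <= 1) (lexx 1) kapM).
  case/andP: g01 => g0 g1.
  have t2 : 0 < (tau0 / 64) ^+ 2 by rewrite exprn_gt0// divr_gt0.
  have -> : eta = g * (g * (tau0 / 64) ^+ 2) by rewrite /eta expr2 -mulrA.
  have gt20 : 0 < g * (tau0 / 64) ^+ 2 by rewrite mulr_gt0.
  apply/andP; split; first by rewrite mulr_gt0.
  apply: (@le_lt_trans _ _ (g * (tau0 / 64) ^+ 2)); last by rewrite /tau0; lra.
  by rewrite ler_piMl// ltW.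
have L1 : 1 < L by lra.
have [s s0 decay] := decay_rate eta01 L1.
pose C0 := 2 * P + theta * (4 * P + 2 * P').
have th0 : 0 <= theta * (4 * P + 2 * P').
  by rewrite mulr_ge0 ?(ltW theta0)// addr_ge0// mulr_ge0.
have C00 : 0 <= C0 by rewrite /C0 addr_ge0// mulr_ge0.
have PC0 : 2 * P <= C0 by rewrite /C0 lerDl.
(* The power converts x^s into h^s, and the added 1 makes [D] positive even when [C0] is 0. *)
pose D := (C0 ^+ 2 + 1) * (kap / rho0 ^+ 2) `^ s.
have D0 : 0 < D.
  rewrite mulr_gt0 ?powR_gt0 ?divr_gt0 ?exprn_gt0//.
  by rewrite ltr_wpDl// sqr_ge0.
exists s, D; split => // h /andP[h0 h1] muX muY cX cY sX sY dX dY no f fL2 f1.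
set f2 := \int[muY]_(y in (supp muY : set T)) normc (f y) ^+ 2.
have f21 : f2 <= 1 by rewrite -lee_fin (f2E cY fL2) L2norm_le1.
have f20 : 0 <= f2 by apply: Rintegral_ge0 => y _; exact: sqr_ge0.
(* The ratio to [rho0] of its dual radius kap h / rho0; the number of available levels is about the
   logarithm of 1/x in base [L]. *)
pose x := kap * h / rho0 ^+ 2.
have kh0 : 0 < kap * h by exact: mulr_gt0.
have r20 : 0 < rho0 ^+ 2 by exact: exprn_gt0.
have x0 : 0 < x by exact: divr_gt0.
have DE : D * h `^ s = (C0 ^+ 2 + 1) * x `^ s.
  rewrite /D -mulrA -powRM ?(ltW h0) ?divr_ge0 ?sqr_ge0 ?(ltW kap0)//.
  by congr (_ * _ `^ _); rewrite /x mulrAC.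
have fin y : 0 <= y -> y <= x `^ s -> y * (C0 ^+ 2 * f2) <= D * h `^ s.
  move=> y0 yx; rewrite DE mulrC; apply: ler_pM => //.
    by rewrite mulr_ge0 ?sqr_ge0.
  by rewrite (le_trans (ler_piMr _ f21)) ?sqr_ge0// lerDl.
(* For [1 <= x] the parameter [h] is bounded below, and the bound without decay is enough because
   x^s is at least 1. *)
have [x1|x1] := leP 1 x.
  apply: le_trans (op_sqint_trivial cPhi cRe cIm M10 P0 P'0 h0 lipPhi pP pP' cY
    sY fL2 cX sX) _.
  rewrite lee_fin -/f2 (le_trans _ (fin 1 _ _))//.
    by rewrite mul1r ler_wpM2r// ler_sqr ?nnegrE ?mulr_ge0.
  by rewrite -(powRr0 x) ler_powR// ltW.
have [m /andP[m1 m2]] : exists m, L ^+ m <= x^-1 < L ^+ m.+1.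
  apply: expn_bracket; first by lra.
  by rewrite invf_ge1// ltW.
pose n := m.+1.
(* With this choice the dual levels k and m - k have radii of product kap * h.
  *)
pose rho := kap * h * L ^+ m / rho0.
have Lm0 : 0 < L ^+ m by rewrite exprn_gt0.
have rhop : 0 < rho by rewrite divr_gt0// !mulr_gt0.
have rho_le : rho <= rho0.
  rewrite ler_pdivrMr// -expr2.
  have : L ^+ m * x <= 1 by rewrite -ler_pdivlMr// mul1r.
  by rewrite /x mulrA ler_pdivrMr ?exprn_gt0// mul1r mulrC.
pose rX k := rho / L ^+ k; pose rY k := rho0 / L ^+ k.
have Lk k : 0 < L ^+ k by rewrite exprn_gt0.
have rS e k : e / L ^+ k.+1 = e / L ^+ k / L.
  by rewrite exprS; field; rewrite !gt_eqF.
have r8 e k : 0 < e -> 8 * (e / L ^+ k.+1) <= e / L ^+ k.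
  move=> e0; rewrite rS mulrA ler_pdivrMr//
    mulrC ler_wpM2l ?divr_ge0 ?(ltW e0) ?(ltW (Lk k))//.
  by lra.
have rX0 k : 0 < rX k by rewrite divr_gt0.
have rY0 k : 0 < rY k by rewrite divr_gt0.
have [TX _] := scale_tree_exists n rX0 (fun k => r8 rho k rhop) cX
  (supp_nonempty cX).
have [TY _] := scale_tree_exists n rY0 (fun k => r8 rho0 k rho00) cY
  (supp_nonempty cY).
have Lmono e i j : 0 < e -> (i <= j)%N -> e / L ^+ j <= e / L ^+ i.
  move=> e0 ij; rewrite ler_wpM2l ?(ltW e0)// lef_pV2 ?posrE// ler_weXn2l//.
  by lra.
have hkap : 4 * h <= kap * h / (L * rho0).
  have Lr : 0 < L * rho0 by exact: mulr_gt0.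
  rewrite ler_pdivlMr//; have ->
    : 4 * h * (L * rho0) = rho0 * (4 * L) * h by ring.
  by rewrite ler_wpM2r// ltW.
have rhoL : rho / L ^+ n = kap * h / (L * rho0).
  by rewrite /rho /n exprS; field; rewrite !gt_eqF.
have low4 e k : rho <= e -> (k <= n)%N -> 4 * h <= e / L ^+ k.
  move=> re kn; apply: (le_trans hkap); rewrite -rhoL.
  apply: (@le_trans _ _ (e / L ^+ n));
    first by rewrite ler_wpM2r// invr_ge0 ltW.
  by apply: Lmono => //; exact: lt_le_trans re.
(* Nonorthogonality asks for strict inequalities; above the last level they follow from the weak one
   a level below, as [L > 1]. *)
have low4s e k : rho <= e -> (k < n)%N -> 4 * h < e / L ^+ k.
  move=> re kn; apply: (@lt_le_trans _ _ (L * (4 * h))).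
    by rewrite ltr_pMl ?mulr_gt0//; lra.
  have := low4 e k.+1 re kn; rewrite rS ler_pdivlMr// mulrC; exact.
have up1 e k : 0 < e -> e <= rho0 -> e / L ^+ k <= rho0.
  move=> e0 er; apply: le_trans er; rewrite ler_pdivrMr//.
  by rewrite ler_peMr ?(ltW e0)// exprn_ege1// ltW.
have gap e k : rho <= e -> e <= rho0 -> (k < n)%N -> 4 * h < e / L ^+ k < 4.
  move=> re er kn; rewrite low4s//=.
  by apply: le_lt_trans (up1 e k (lt_le_trans rhop re) er) _; lra.
have rr k : (k < n)%N -> rX k * rY (n.-1 - k)%N = kap * h.
  rewrite ltnS => km; rewrite /rX /rY /=.
  have -> : rho / L ^+ k * (rho0 / L ^+ (m - k)) =
    rho * rho0 / (L ^+ k * L ^+ (m - k)).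
    by field; rewrite !gt_eqF.
  by rewrite -exprD subnKC// /rho; field; rewrite !gt_eqF.
have weights e k : 0 < e -> e <= rho0 -> 2 ^+ q * (e / L ^+ k) <= 4.
  move=> e0 er; apply: (@le_trans _ _ (2 ^+ q * rho0)); last by lra.
  by rewrite ler_wpM2l ?(ltW q0)// up1.
have rL e k : e / L ^+ k = L * (e / L ^+ k.+1).
  by rewrite rS; field; rewrite !gt_eqF.
have gX k t : (k < n)%N ->
    g * level_sum (@mass R d muX rX n TX) k (anc k t) <=
      level_sum (@mass R d muX rX n TX) k.+1 (anc k.+1 t).
  move=> kn; apply: (mass_doubling cX t kn CD1 dX (rX0 _) (rL _ _)) => //.
    exact: low4.
  exact: weights.
have gY k t : (k < n)%N ->
    g * level_sum (@mass R d muY rY n TY) k (anc k t) <=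
      level_sum (@mass R d muY rY n TY) k.+1 (anc k.+1 t).
  move=> kn; apply: (mass_doubling cY t kn CD1 dY (rY0 _) (rL _ _)) => //.
    exact: low4.
  exact: weights.
have rX1 : rX 0%N <= 1 by rewrite /rX expr0 divr1; apply: le_trans rho01.
have kapM' : M * kap <= 1 by rewrite kapM.
have := op_sqint_trees cPhi cRe cIm (ltW M0) M10 P0 P'0 h0 mixed_le lipPhi pP
  pP' cY sY fL2
  cX sX (isT : (0 < n)%N) M11 cN01 g01 no gX gY rX0 rY0 (rS rho) (rS rho0) kap0
    kapM'
  L16 LM Ltheta rr (fun k kn => gap rho k (lexx _) rho_le kn)
    (fun k kn => gap rho0 k rho_le (lexx _) kn) rX1.
move=> /le_trans; apply; rewrite lee_fin -/f2.
have y1 : (1 - eta) ^+ n <= x `^ s by exact: decay.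
apply: fin y1; rewrite exprn_ge0// subr_ge0 ltW//; by case/andP: eta01.
Qed.

End conclusion.

Section box_kernels.
Variables (R : realType) (d : nat) (a b : 'rV[R]_d).
Local Notation K := (prod_rV (unit_box a) (unit_box b)).

Lemma C1_complex_bounds (p : 'rV[R]_d -> 'rV[R]_d -> R[i]) :
  C_on 1 K (fun z => complex.Re (p (lsubmx z) (rsubmx z))) ->
  C_on 1 K (fun z => complex.Im (p (lsubmx z) (rsubmx z))) ->
  exists P P', [/\ 0 <= P, 0 <= P',
    forall x y, unit_box a x -> unit_box b y -> normc (p x y) <= P &
    forall x x' y, unit_box a x -> unit_box a x' -> unit_box b y ->
      normc (p x y - p x' y) <= P' * `|x - x'|].
Proof.
move=> hRe hIm.
have [PR PR0 pR] := C0_bounded (F := fun x y => complex.Re (p x y))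
  (conj hRe.1 I).
have [PI PI0 pI] := C0_bounded (F := fun x y => complex.Im (p x y))
  (conj hIm.1 I).
have [LR LR0 lR] := C1_lipschitz_l (F := fun x y => complex.Re (p x y)) hRe.
have [LI LI0 lI] := C1_lipschitz_l (F := fun x y => complex.Im (p x y)) hIm.
exists (PR + PI), (LR + LI); split; [exact: addr_ge0|exact: addr_ge0| |].
  move=> x y ax yb; rewrite (le_trans (normc_le_ReIm _))// lerD//;
    [exact: pR|exact: pI].
move=> x x' y ax ax' yb; rewrite (le_trans (normc_le_ReIm _))// mulrDl lerD//.
  rewrite (_ : complex.Re _ = complex.Re (p x y) - complex.Re (p x' y));
    first exact: lR.
  by case: (p x y) (p x' y) => ? ? [].
rewrite (_ : complex.Im _ = complex.Im (p x y) - complex.Im (p x' y));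
  first exact: lI.
by case: (p x y) (p x' y) => ? ? [].
Qed.

End box_kernels.

Unset Implicit Arguments.

Theorem theorem1p4 (R : realType) (d : nat) (hd : (1 <= d)%N)
    (a b : 'rV[R]_d)
    (Phi : 'rV[R]_d -> 'rV[R]_d -> R) (p : 'rV[R]_d -> 'rV[R]_d -> R[i])
    (CDX CDY cN : R)
    (hPhi : C_on 3 (prod_rV (unit_box a) (unit_box b))
              (fun z => Phi (lsubmx z) (rsubmx z)))
    (hRep : C_on 1 (prod_rV (unit_box a) (unit_box b))
              (fun z => complex.Re (p (lsubmx z) (rsubmx z))))
    (hImp : C_on 1 (prod_rV (unit_box a) (unit_box b))
              (fun z => complex.Im (p (lsubmx z) (rsubmx z))))
    (hCDX : 0 < CDX) (hCDY : 0 < CDY) (hcN : 0 < cN <= 1) :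
  exists eps0 C : R, [/\ 0 < eps0, 0 < C &
    forall h : R, 0 < h < 1 ->
    forall muX muY : probability (borel_rV R d) R,
      compact (supp muX) -> compact (supp muY) ->
      supp muX `<=` unit_box a -> supp muY `<=` unit_box b ->
      doubling muX h CDX -> doubling muY h CDY ->
      nonorthogonal Phi (supp muX) (supp muY) cN h h 1 1 ->
      (forall f, inL2 muY f -> inL2 muX (oscillatory_op Phi p h muY f)) /\
      (L2_opnorm muY muX (oscillatory_op Phi p h muY) <= (C * h `^ eps0)%:E)%E].
Proof.
have hPhi2 : C_on 2 (prod_rV (unit_box a) (unit_box b))
    (fun z => Phi (lsubmx z) (rsubmx z)).
  by move: hPhi; rewrite prod_unit_box => /C_onW.
have hPhi1 : C_on 1 (prod_rV (unit_box a) (unit_box b))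
    (fun z => Phi (lsubmx z) (rsubmx z)).
  by move: hPhi2; rewrite prod_unit_box => /C_onW.
have [M M1 mixed_le] := C2_mixed hPhi2.
have [B B0 lipPhi] := C1_lipschitz_l hPhi1.
have [P [P' [P0 P'0 pP pP']]] := C1_complex_bounds hRep hImp.
have cPhi x (ax : unit_box a x) := continuous_r hPhi.1 ax.
have cRe x (ax : unit_box a x) :=
  continuous_r (F := fun x y => complex.Re (p x y)) hRep.1 ax.
have cIm x (ax : unit_box a x) :=
  continuous_r (F := fun x y => complex.Im (p x y)) hImp.1 ax.
(* A common doubling constant for both measures, at least 1 so that [g], the inverse of a power of
   it, is at most 1. *)
pose CD := 1 + CDX + CDY.
have CD1 : 1 <= CD by rewrite /CD; lra.
have [s [D [s0 D0 decay]]] := sqint_decay cPhi cRe cIm M1 B0 P0 P'0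
  mixed_le lipPhi pP pP' CD1 hcN.
(* [decay] bounds the square of the norm, hence the halved exponent and the root. *)
exists (s / 2), (Num.sqrt D); split;
  [by rewrite divr_gt0|by rewrite sqrtr_gt0|].
move=> h h01 muX muY cX cY sX sY dX dY no; have /andP[h0 h1] := h01.
split=> [f fL2|].
  exact: (op_inL2 cPhi cRe cIm B0 P0 P'0 h0 lipPhi pP pP' cY sY fL2 cX sX).
apply: ge_ereal_sup => _ [f [fL2 f1] <-].
apply: L2norm_le; first by rewrite mulr_ge0 ?sqrtr_ge0 ?powR_ge0.
have -> : (Num.sqrt D * h `^ (s / 2)) ^+ 2 = D * h `^ s.
  rewrite exprMn sqr_sqrtr ?(ltW D0)// -powR_mulrn ?powR_ge0// -powRrM.
  by rewrite divfK.
by apply: decay => //; [apply: doublingW dX|apply: doublingW dY]; rewrite /CD;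
  lra.
Qed.
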